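(* Let $m\ge0$ and let $f$ be a bounded measurable function on $[0,\infty)^{m+1}$. Then there exists $L_m(f)\in\mathbb R$, independent of $\alpha$, such that for a.e. $\alpha\in(0,1)$, as $\eta\to0^+$, $$\frac{1}{\ln(1/\eta)}\int_\eta^1f\big(\delta_{N(\alpha,\epsilon)}(\alpha,\epsilon),\delta_{N(\alpha,\epsilon)-1}(\alpha,\epsilon),\dots,\delta_{N(\alpha,\epsilon)-m}(\alpha,\epsilon)\big)\frac{d\epsilon}{\epsilon}\to L_m(f)$$ and $$\frac{1}{\ln(1/\eta)}\int_\eta^1(-1)^{N(\alpha,\epsilon)}f\big(\delta_{N(\alpha,\epsilon)}(\alpha,\epsilon),\dots,\delta_{N(\alpha,\epsilon)-m}(\alpha,\epsilon)\big)\frac{d\epsilon}{\epsilon}\to0.$$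
   Context: For irrational $\alpha\in(0,1)$ let $T(x)=1/x-[1/x]$ be the Gauss map, $a_n=[1/T^{n-1}\alpha]$ for $n\ge1$, and define $p_0=1,p_1=0$, $q_0=0,q_1=1$, $p_{n+1}=a_np_n+p_{n-1}$, $q_{n+1}=a_nq_n+q_{n-1}$, and $d_n(\alpha)=|q_n\alpha-p_n|$ (so $d_0=1$, $d_1=\alpha$, $d_{n+1}=-a_nd_n+d_{n-1}$). For $\epsilon\in(0,1]$, $N(\alpha,\epsilon)=\inf\{n\ge0:d_n(\alpha)\le\epsilon\}$ and $\delta_n(\alpha,\epsilon)=d_n(\alpha)/\epsilon$. (When an index $N(\alpha,\epsilon)-k$ is negative, which happens only for $\epsilon$ in a fixed neighbourhood of $1$, any fixed convention may be used; it does not affect the limits.) *)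

(* Defs.v *)
From HB Require Import structures.
From mathcomp Require Import all_boot all_order all_algebra.
From mathcomp Require Import all_classical all_reals all_analysis.
Set Implicit Arguments. Unset Strict Implicit. Unset Printing Implicit Defensive.
Import Order.TTheory GRing.Theory Num.Theory.
Local Open Scope ring_scope.

Section CF.
Variable R : realType.

Definition gaussT (x : R) : R := x^-1 - (Num.floor (x^-1))%:~R.

Definition cf_a (alpha : R) (n : nat) : R :=
  (Num.floor ((iter n.-1 gaussT alpha)^-1))%:~R.

(* cf_pq alpha n = ((p_n, p_{n+1}), (q_n, q_{n+1})) with
   p_0 = 1, p_1 = 0, q_0 = 0, q_1 = 1,
   p_{n+1} = a_n p_n + p_{n-1}, q_{n+1} = a_n q_n + q_{n-1}. *)
Fixpoint cf_pq (alpha : R) (n : nat) : (R * R) * (R * R) :=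
  match n with
  | 0 => ((1, 0), (0, 1))
  | n'.+1 =>
      let: ((p0, p1), (q0, q1)) := cf_pq alpha n' in
      ((p1, cf_a alpha n'.+1 * p1 + p0), (q1, cf_a alpha n'.+1 * q1 + q0))
  end.

Definition cf_p (alpha : R) (n : nat) : R := (cf_pq alpha n).1.1.
Definition cf_q (alpha : R) (n : nat) : R := (cf_pq alpha n).2.1.

Definition cf_d (alpha : R) (n : nat) : R := `| cf_q alpha n * alpha - cf_p alpha n |.

(* N(alpha, eps) = inf {n >= 0 : d_n(alpha) <= eps}  (0 if the set is empty,
   which never happens for irrational alpha) *)
Definition cf_N (alpha eps : R) : nat :=
  match pselect (exists n, cf_d alpha n <= eps) with
  | left H => ex_minn H
  | right _ => 0%N
  end.

Definition cf_delta (alpha eps : R) (n : nat) : R := cf_d alpha n / eps.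

(* the vector (delta_N, delta_{N-1}, ..., delta_{N-m}); negative indices
   are truncated to 0 (convention N - k := 0 when k > N) *)
Definition delta_vec (m : nat) (alpha eps : R) : m.+1.-tuple R :=
  [tuple cf_delta alpha eps (cf_N alpha eps - i)%N | i < m.+1].

End CF.

(* Main.v *)
(** By multiplicativity [d_n = x * T x * ... * T^(n-1) x], and on the block
    [d_n <= eps < d_(n-1)] all the arguments of [f] are ratios of such products.
    As [d eps / eps] is scale invariant, the integral over the [n]-th block is
    [F (T^(n-m-1) alpha)] for one function [F] dominated by [|ln (T^m x)|], and
    [ln (1/eta)] is itself a Birkhoff sum of [- ln] up to one term.  So both
    limits follow from Birkhoff's theorem for the Gauss measure: the first is the
    quotient of the integrals of [F] and [- ln], and the alternating sum vanishes
    because already [T^2] is ergodic, so that even and odd times have the same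
    averages.  Ergodicity comes from the bounded distortion of the inverse
    branches together with Lebesgue's density theorem. *)
Require Import Defs.
From HB Require Import structures.
From mathcomp Require Import all_boot all_order all_algebra.
From mathcomp Require Import all_classical all_reals all_analysis.
From mathcomp Require Import measurable_realfun ring lra zify.
Import numFieldNormedType.Exports.
Import Order.TTheory GRing.Theory Num.Theory.
Local Open Scope ring_scope.
Local Open Scope classical_set_scope.

Set Implicit Arguments. Unset Strict Implicit. Unset Printing Implicit Defensive.

(** * Orbits and inverse branches of the Gauss map *)

Section gauss_orbit.
Context {R : realType}.
Implicit Types (x y t : R) (n : nat).

(** The obstacle is that [F] is in general unbounded: it is only integrable, through the exponential
    tail of [- ln] under the Gauss measure, so a pointwise ergodic theorem in L^1 is required. It is
    reached with one invariant set. For [g] of negative integral, the points whose orbit sums of [g]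
    are bounded above form an exactly invariant set, hence null or full; were it null, the maximal
    inequality would make the integral nonnegative. Applied to [g] minus its mean, and to the
    opposite, with a small slack, this bounds the averages from both sides. The argument runs for
    the square of [T]; [T] itself is recovered by splitting the times by parity. The shift by
    [m + 1] in the argument of [F] makes every distance met in a block a multiple of one earlier
    distance, so that the block rescales to one of a later orbit point. The finitely many blocks
    that come too early are lost in the average. A sign [s], equal to [1] or [-1], carries both
    limits through the same lemmas. *)

Lemma measurable_invr : measurable_fun [set: R] GRing.inv.
Proof.
rewrite -(setUv [set (0 : R)]); apply/measurable_funU => //.
  exact: measurableC.
split; first exact: measurable_fun_set1.
apply: subspace_continuous_measurable_fun; first exact: measurableC.
by apply: continuous_in_subspaceT => x; rewrite inE => /eqP; exact: inv_continuous.
Qed.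

Lemma measurable_gaussT : measurable_fun [set: R] (@gaussT R).
Proof.
apply: measurable_funB; first exact: measurable_invr.
suff mfl : measurable_fun [set: R] (fun x : R => (Num.floor x)%:~R : R).
  exact: (measurableT_comp mfl measurable_invr).
apply: nondecreasing_measurable => // x y xy.
by rewrite ler_int; exact: le_floor.
Qed.

Lemma measurable_iter_gaussT n : measurable_fun [set: R] (iter n (@gaussT R)).
Proof.
elim: n => [|n IH]; first exact: measurable_id.
exact: measurableT_comp measurable_gaussT IH.
Qed.

(** The only consequence of irrationality that is used later: the orbit never reaches 0, where
    [gaussT] takes a meaningless value from the convention [0^-1 = 0]. *)
Definition regular x := forall n, 0 < iter n (@gaussT R) x < 1.

Definition orbit_prod x n : R := \prod_(k < n) iter k (@gaussT R) x.

Lemma gaussT_itv x : 0 <= gaussT x < 1.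
Proof.
by rewrite /gaussT subr_ge0 floor_le_tmp ltrBlDl -[X in _ < _ + X]mulr1z -intrD floorD1_gt.
Qed.

Lemma rational_gaussT x : rational (gaussT x) -> rational x.
Proof.
move=> [q _ qx]; exists (q + (Num.floor x^-1)%:~R)^-1 => //.
by rewrite fmorphV rmorphD/= qx ratr_int /gaussT subrK invrK.
Qed.

Lemma irrational_regular x : irrational x -> 0 < x < 1 -> regular x.
Proof.
move=> xirr x01 [//|n]; rewrite iterS.
have irr k : irrational (iter k (@gaussT R) x).
  elim: k => [//|k IH]; rewrite iterS => h; exact/IH/rational_gaussT.
have /andP[T0 ->] := gaussT_itv (iter n (@gaussT R) x).
rewrite andbT lt_def T0 andbT; apply/eqP => Te; apply: (irr n.+1).
by exists 0 => //; rewrite iterS Te raddf0.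
Qed.

Lemma regular_gaussT x n : regular x -> regular (iter n (@gaussT R) x).
Proof. by move=> xr k; rewrite -iterD. Qed.

Lemma floor_inv_ge1 x : 0 < x < 1 -> 1 <= (Num.floor x^-1)%:~R :> R.
Proof.
move=> /andP[x0 x1]; rewrite -[1]mulr1z ler_int floor_ge_int_tmp.
by rewrite mulr1z invf_ge1 // ltW.
Qed.

Lemma gaussT_inv (a : int) t : 0 < t < 1 -> gaussT (a%:~R + t)^-1 = t.
Proof.
move=> /andP[t0 t1]; rewrite /gaussT invrK.
suff -> : Num.floor (a%:~R + t) = a by rewrite addrC addKr.
by apply: floor_def; rewrite lerDl ltW//= intrD ltrD2l.
Qed.

Lemma orbit_prodS x n : orbit_prod x n.+1 = orbit_prod x n * iter n (@gaussT R) x.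
Proof. by rewrite /orbit_prod big_ord_recr. Qed.

Lemma orbit_prodD x m n :
  orbit_prod x (m + n) = orbit_prod x m * orbit_prod (iter m (@gaussT R) x) n.
Proof.
elim: n => [|n IH]; first by rewrite addn0 [X in _ * X]/orbit_prod big_ord0 mulr1.
by rewrite addnS !orbit_prodS IH mulrA -iterD addnC.
Qed.

Lemma orbit_prod_gt0 x n : regular x -> 0 < orbit_prod x n.
Proof. by move=> xr; apply: prodr_gt0 => k _; case/andP: (xr k). Qed.

Lemma orbit_prod0 x : orbit_prod x 0 = 1.
Proof. by rewrite /orbit_prod big_ord0. Qed.

Lemma orbit_prodS_lt x n : regular x -> orbit_prod x n.+1 < orbit_prod x n.
Proof.
move=> xr; rewrite orbit_prodS gtr_pMr ?orbit_prod_gt0//.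
by case/andP: (xr n).
Qed.

(** With [a] the integer part of [x^-1], the product is [1 - a x], hence at most [1 - x]; it is also
    at most [x]. So the distances halve at least every second step. *)
Lemma mul_gaussT_le x : 0 < x < 1 -> x * gaussT x <= 2^-1.
Proof.
move=> /[dup] x01 /floor_inv_ge1; case/andP: x01 => x0 x1 a1.
have /andP[T0 T1] := gaussT_itv x.
have E : x * gaussT x = 1 - (Num.floor x^-1)%:~R * x.
  by rewrite /gaussT mulrBr mulfV ?gt_eqF// mulrC.
move: E a1 T0 T1; set t := gaussT x; set a := (_ %:~R) => E a1 T0 T1.
nra.
Qed.

Lemma orbit_prod_le x n : regular x -> orbit_prod x n.*2 <= 2^-1 ^+ n.
Proof.
move=> xr; elim: n => [|n IH]; first by rewrite orbit_prod0.
rewrite doubleS 2!orbit_prodS exprSr -mulrA iterS.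
apply: ler_pM => //; first exact/ltW/orbit_prod_gt0.
- rewrite mulr_ge0//; first by have /andP[/ltW] := xr n.*2.
  by have /andP[] := gaussT_itv (iter n.*2 (@gaussT R) x).
- exact: mul_gaussT_le.
Qed.

Lemma cf_pSS x n : cf_p x n.+2 = cf_a x n.+1 * cf_p x n.+1 + cf_p x n.
Proof. by rewrite /cf_p /=; case: (cf_pq x n) => [[? ?] [? ?]]. Qed.

Lemma cf_qSS x n : cf_q x n.+2 = cf_a x n.+1 * cf_q x n.+1 + cf_q x n.
Proof. by rewrite /cf_q /=; case: (cf_pq x n) => [[? ?] [? ?]]. Qed.

Lemma cf_dE x n : regular x -> cf_d x n = orbit_prod x n.
Proof.
move=> xr.
(* Without absolute values the differences alternate in sign and obey a linear two-term recursion,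
   hence two consecutive indices in the induction. The recursion matches that of the products
   because [y * gaussT y = 1 - a * y]. *)
have H k : cf_q x k * x - cf_p x k = (-1) ^+ k.+1 * orbit_prod x k /\
   cf_q x k.+1 * x - cf_p x k.+1 = (-1) ^+ k * orbit_prod x k.+1.
  elim: k => [|k [IH1 IH2]].
    rewrite /cf_q /cf_p/= orbit_prodS orbit_prod0 !mul1r !mul0r subr0.
    by split=> //; rewrite sub0r expr1 mulr1.
  split; first by rewrite exprS mulN1r exprS mulN1r opprK.
  rewrite cf_qSS cf_pSS.
  have -> : (cf_a x k.+1 * cf_q x k.+1 + cf_q x k) * x -
    (cf_a x k.+1 * cf_p x k.+1 + cf_p x k) =
    cf_a x k.+1 * (cf_q x k.+1 * x - cf_p x k.+1) + (cf_q x k * x - cf_p x k) by ring.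
  rewrite IH1 IH2 !orbit_prodS /cf_a/=.
  have /andP[y0 _] := xr k; move: y0; set y := iter k _ x => y0.
  rewrite [gaussT y]/gaussT; set a := (_%:~R); rewrite exprS.
  field; exact: lt0r_neq0.
by rewrite /cf_d (H n).1 normrM normrX normrN1 expr1n mul1r ger0_norm// ltW// orbit_prod_gt0.
Qed.

(* The branch of the inverse of [T^n] through [x] is the Moebius map
   [t |-> (p + p' t) / (q + q' t)] with [|p q' - p' q| = 1] and [q' <= q], so
   its distortion is bounded. *)
Lemma moebius_branch x n : regular x -> exists p p' q q' : R,
  [/\ [/\ 0 <= q', 1 <= q & q' <= q], `|p' * q - p * q'| = 1, n.+1%:R <= q + q',
      x = (p + p' * iter n (@gaussT R) x) / (q + q' * iter n (@gaussT R) x) &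
      forall t, 0 < t < 1 -> iter n (@gaussT R) ((p + p' * t) / (q + q' * t)) = t].
Proof.
move=> xr; elim: n => [|n [p [p' [q [q' [[q'0 q1 q'q] det qn xE branch]]]]]].
  exists 0, 1, 1, 0; split => //=.
  - by rewrite !mulr1 mulr0 subr0 normr1.
  - by rewrite addr0.
  - by rewrite !mul0r mul1r add0r addr0 divr1.
  - by move=> t _; rewrite !mul0r mul1r add0r addr0 divr1.
have y01 := xr n; have a1 := floor_inv_ge1 y01.
have z0 : 0 < gaussT (iter n (@gaussT R) x) by have /andP[] := xr n.+1.
have yE : iter n (@gaussT R) x = ((Num.floor (iter n (@gaussT R) x)^-1)%:~R +
    gaussT (iter n (@gaussT R) x))^-1.
  by rewrite {3}/gaussT addrCA subrr addr0 invrK.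
have y0 : iter n (@gaussT R) x != 0 by rewrite gt_eqF//; case/andP: y01.
have bE (a t : R) : 1 <= a -> 0 < t -> (p + p' * (a + t)^-1) / (q + q' * (a + t)^-1) =
    (a * p + p' + p * t) / (a * q + q' + q * t).
  move=> a1' t0; field; apply/andP; split; apply/eqP; nra.
(* Composition with [t |-> (a + t)^-1] multiplies the matrix of the Moebius map by one of
   determinant [-1]. As [a >= 1] and [q >= 1], the sum [q + q'] grows by at least 1. *)
exists ((Num.floor (iter n (@gaussT R) x)^-1)%:~R * p + p'), p,
  ((Num.floor (iter n (@gaussT R) x)^-1)%:~R * q + q'), q; split.
- by split; nra.
- by rewrite -det -normrN; congr (`| _ |); ring.
- by rewrite -natr1; nra.
- by rewrite iterS {1}xE {1 2}yE bE.
- move=> t t01; have /andP[t0 t1] := t01.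
  rewrite -bE// iterS branch ?gaussT_inv//.
  by rewrite invr_gt0 invf_lt1; lra.
Qed.

(** For a Moebius map of determinant [1] in absolute value, [psi t - psi s] is, up to sign,
    [(t - s) / ((q + q' t) (q + q' s))]. With [K = (q + q')^2] the denominator is at most [K], which
    gives the expansion bound, and at least [q^2 >= K / 4] since [q' <= q], which gives the
    [4 / K]. *)
Lemma inverse_branch x n : regular x -> exists (K : R) (psi : R -> R),
  [/\ n.+1%:R <= K /\ measurable_fun setT psi,
      forall t, 0 < t < 1 -> iter n (@gaussT R) (psi t) = t,
      forall s t, 0 < s < 1 -> 0 < t < 1 -> `|t - s| <= K * `|psi t - psi s| &
      forall t, 0 < t < 1 -> `|x - psi t| < 4 / K].
Proof.
move=> xr.
have [p [p' [q [q' [[q'0 q1 q'q] det qn xE branch]]]]] := moebius_branch n xr.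
have diff s t : 0 < s < 1 -> 0 < t < 1 ->
    `|(p + p' * t) / (q + q' * t) - (p + p' * s) / (q + q' * s)| =
    `|t - s| / ((q + q' * t) * (q + q' * s)).
  move=> /andP[s0 s1] /andP[t0 t1].
  have st0 : 0 < (q + q' * t) * (q + q' * s) by apply: mulr_gt0; nra.
  rewrite -[RHS]mul1r -det -[X in _ = _ * (_ / X)]ger0_norm ?(ltW st0)//.
  rewrite -normf_div -normrM; congr (`| _ |); field.
  by apply/andP; split; apply/eqP; nra.
exists ((q + q') ^+ 2), (fun t => (p + p' * t) / (q + q' * t)); split => //.
- split; last first.
    have mlin (a b : R) : measurable_fun setT (fun t : R => a + b * t).
      by apply: measurable_funD => //; exact: mulrl_measurable.
    apply: measurable_funM; first exact: mlin.
    exact: (measurableT_comp measurable_invr (mlin q q')).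
  by rewrite (le_trans qn)// expr2 ler_peMr//; lra.
- move=> s t s01 t01; rewrite diff//.
  move: s01 t01 => /andP[s0 s1] /andP[t0 t1].
  rewrite mulrCA -[leLHS]mulr1 ler_wpM2l// ler_pdivlMr ?mul1r ?expr2.
    by apply: ler_pM; nra.
  by apply: mulr_gt0; nra.
- move=> t t01; rewrite {1}xE diff//; have y01 := xr n.
  set y := iter n _ x in y01 *.
  rewrite ltr_pdivlMr ?exprn_gt0//; last lra.
  have d1 : `|y - t| < 1.
    by move: y01 t01 => /andP[? ?] /andP[? ?]; rewrite ltr_norml; lra.
  move: y01 t01 => /andP[y0 y1] /andP[t0 t1].
  rewrite mulrAC ltr_pdivrMr; last by apply: mulr_gt0; nra.
  apply: (@lt_le_trans _ _ ((q + q') ^+ 2)).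
    by rewrite gtr_pMl// exprn_gt0//; nra.
  have : q * q <= (q + q' * y) * (q + q' * t) by apply: ler_pM; nra.
  by rewrite expr2; nra.
Qed.

End gauss_orbit.

(** * Domination of measures by multiples of Lebesgue measure *)

Section measure_comparison.
Context {R : realType}.
Local Notation leb := (@lebesgue_measure R).

(** Lebesgue measure is an infimum over countable covers by half-open intervals, and [nu] is
    subadditive on each such cover. *)
Lemma measure_le_lebesgue (nu : {measure set (measurableTypeR R) -> \bar R}) (C : R) :
  0 < C -> (forall a b : R, a <= b -> (nu `]a, b]%classic <= (C * (b - a))%:E)%E) ->
  forall A, measurable A -> (nu A <= C%:E * leb A)%E.
Proof.
move=> C0 nuC A mA; rewrite -lee_pdivrMl//.
apply: le_ereal_inf_tmp => _ [F [mF AF] <-].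
rewrite lee_pdivrMl// -nneseriesZl//.
have mFb n : measurable (F n : set (measurableTypeR R)).
  exact: sub_sigma_algebra.
apply: (le_trans (measure_sigma_subadditive nu mFb mA AF)).
apply: lee_nneseries => [n _ _|n _]; first exact: measure_ge0.
have /ocitvP[->|[[a b]/= ab ->]] := mF n.
  by rewrite measure0 mule_ge0 ?wlength_ge0// lee_fin ltW.
by rewrite wlength_itv_bnd ?(ltW ab)//= -EFinM; apply: nuC; exact: ltW.
Qed.

Lemma lebesgue_measure_le_diam (A : set R) (d : R) : measurable A -> 0 <= d ->
  (forall s t, A s -> A t -> t - s <= d) -> (leb A <= d%:E)%E.
Proof.
move=> mA d0 Ad; have [->|/set0P[a Aa]] := eqVneq A set0; first by rewrite measure0 lee_fin.
have hs : has_sup A.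
  by split; [exists a|exists (a + d) => t At; rewrite -lerBlDl Ad].
have hi : has_inf A.
  by split; [exists a|exists (a - d) => t At; rewrite lerBlDl -lerBlDr Ad].
have sub : A `<=` `[inf A, sup A].
  move=> t At; rewrite /= in_itv/=; apply/andP.
  by split; [apply: ge_inf => //; case: hi|apply: ub_le_sup => //; case: hs].
apply: (le_trans (le_measure leb _ _ sub)); rewrite ?inE//.
rewrite /= lebesgue_measure_itv/=; case: ifP => // _.
rewrite -EFinD lee_fin lerBlDl; apply: ge_sup; first by exists a.
move=> t At; rewrite -lerBlDr; apply: lb_le_inf; first by exists a.
by move=> s As; rewrite lerBlDl -lerBlDr Ad.
Qed.

(** The pushforward by [psi] of Lebesgue measure restricted to [D] is compared with Lebesgue
    measure: the preimage of an interval of length [b - a] has diameter at most [K (b - a)]. *)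
Lemma lebesgue_measure_expansion (D : set R) (psi : R -> R) (K : R) :
  measurable D -> measurable_fun setT psi -> 0 < K ->
  (forall s t, D s -> D t -> `|t - s| <= K * `|psi t - psi s|) ->
  forall B, measurable B -> (leb (D `&` psi @^-1` B) <= K%:E * leb B)%E.
Proof.
move=> mD mpsi K0 psiK B mB.
rewrite setIC.
apply: (@measure_le_lebesgue (pushforward (mrestr leb mD)
  (psi : R -> measurableTypeR R))) => // a b ab.
apply: lebesgue_measure_le_diam.
- by apply: measurableI => //; rewrite -[X in measurable X]setTI; exact: mpsi.
- by rewrite mulr_ge0 ?subr_ge0// ltW.
- move=> s t [/= sab Ds] [tab Dt].
  apply: (le_trans (ler_norm _)); apply: (le_trans (psiK _ _ Ds Dt)).
  rewrite ler_pM2l// ler_norml.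
  by move: sab tab; rewrite !in_itv/= => /andP[? ?] /andP[? ?]; lra.
Qed.

End measure_comparison.

(** * Ergodicity of the square of the Gauss map *)

Section gauss_ergodic.
Context {R : realType}.
Local Notation leb := (@lebesgue_measure R).
Local Notation T := (@gaussT R).

Lemma ae_regular : {ae leb, forall x, 0 < x < 1 -> regular x}.
Proof.
have : leb.-negligible (range ratr : set R).
  exists (range ratr : set R); split => //; last exact: lebesgue_measure_rat.
  by rewrite -bigcup_imset1; exact: bigcupT_measurable_rat.
apply: negligibleS => x /= nreg; apply: contrapT => irr; apply: nreg => x01.
exact: irrational_regular.
Qed.

(* On the image of the inverse branch [psi] of [T^(2n)] through [x], which has
   diameter of the order of [K^-1], membership in [A] is membership of the
   parameter in [A]; so [A] has a fixed proportion in small balls around [x],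
   against Lebesgue density at [x]. *)
Lemma gaussT_ergodic (A : set R) : measurable A ->
  (forall x, A (T (T x)) <-> A x) ->
  leb (A `&` `]0, 1[) = 0%E \/ leb (`]0, 1[ `\` A) = 0%E.
Proof.
move=> mA invA; have [|c0] := eqVneq (leb (A `&` `]0, 1[)) 0%E; [by left|right].
have m01 : measurable (`]0, 1[ : set R) by exact: measurable_itv.
apply/negligibleP; first exact: measurableD.
have invA2 n x : A (iter n.*2 T x) <-> A x.
  elim: n => [//|n IH]; rewrite doubleS 2!iterS; rewrite -IH; exact: invA.
have cfin : (leb (A `&` `]0%R, 1%R[) <= 1)%E.
  apply: (le_trans (le_measure leb _ _ (@subIsetr _ A `]0%R, 1%R[))); rewrite ?inE//.
  - exact: measurableI.
  - by rewrite /= lebesgue_measure_itv/= lte_fin ltr01 oppr0 adde0.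
apply: (negligibleS _ (negligibleU ae_regular (lebesgue_density mA))).
move=> x [/= + nAx]; rewrite in_itv/= => x01.
apply: contrapT => /not_orP[/contrapT/(_ x01) xreg /contrapT].
rewrite indicE memNset// => dens.
have ce : (leb (A `&` `]0, 1[)) = (fine (leb (A `&` `]0, 1[)))%:E.
  by rewrite fineK// ge0_fin_numE// (le_lt_trans cfin)// ltry.
move: c0 cfin; rewrite ce; set c := fine _; rewrite eqe lee_fin => c0 c1.
have cpos : 0 < c by rewrite lt_def c0 /c fine_ge0.
(* The ball of radius [4 / K] has measure [8 / K], and [A] will be shown to fill at least [c / K] of
   it; the threshold [c / 8] is the ratio of the two. *)
have [d /= d0 Hd] : \forall r \near 0^'+,
    (leb (A `&` ball x r) * (leb (ball x r))^-1 < (c / 8)%:E)%E.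
  suff : nbhs (0 : \bar R)%E [set y | (y < (c / 8)%:E)%E] by move/dens.
  apply: open_nbhs_nbhs; split; first exact: open_ereal_lt_ereal.
  by rewrite /= lte_fin divr_gt0.
pose n := `|Num.ceil (4 / d)|%N.
have [K [psi [[nK mpsi] psiT psiK psix]]] := inverse_branch n.*2 xreg.
have K0 : 0 < K by apply: lt_le_trans nK.
have Kd : 4 / K < d.
  rewrite ltr_pdivrMr// mulrC -ltr_pdivrMr//; apply: lt_le_trans nK.
  apply: (@le_lt_trans _ _ n%:R); last by rewrite ltr_nat ltnS -addnn leq_addr.
  rewrite /n natr_absz ger0_norm ?ceil_ge//.
  by rewrite -(ler_int R) (le_trans _ (ceil_ge _))// divr_ge0// ltW.
have r0 : 0 < 4 / K by rewrite divr_gt0.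
have mB : measurable (A `&` ball x (4 / K)).
  by apply: measurableI => //; exact: measurable_ball.
have := Hd (4 / K); rewrite /= sub0r normrN gtr0_norm// => /(_ Kd r0).
apply/negP; rewrite -leNgt lebesgue_measure_ball ?(ltW r0)//.
have : (leb (`]0%R, 1%R[ `&` psi @^-1` (A `&` ball x (4 / K))) <=
    K%:E * leb (A `&` ball x (4 / K)))%E.
  apply: lebesgue_measure_expansion => // s t /=; rewrite !in_itv/=; exact: psiK.
(* Invariance of [A] together with [T^(2n) (psi t) = t] gives [psi t \in A] exactly when [t \in A],
   while [psi t] always lies in the ball. *)
have -> : `]0%R, 1%R[ `&` psi @^-1` (A `&` ball x (4 / K)) = A `&` `]0%R, 1%R[.
  apply/seteqP; split => [t [/= t01 [At _]]|t [At /= t01]].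
    by split => //; move/(invA2 n): At; rewrite psiT//; rewrite in_itv/= in t01.
  split => //; split; last by apply: psix; rewrite in_itv/= in t01.
  by apply/(invA2 n); rewrite psiT//; rewrite in_itv/= in t01.
rewrite ce -/c => cK.
rewrite inver mulrn_eq0/= gt_eqF// muleC.
rewrite (_ : (4 / K *+ 2)^-1 = K / 8); last by rewrite -mulr_natr; field; exact: lt0r_neq0.
rewrite [K / 8]mulrC [c / 8]mulrC !EFinM -muleA.
by rewrite lee_pmul2l.
Qed.

End gauss_ergodic.

(** * The Gauss measure *)

Section gauss_measure.
Context {R : realType}.
Local Notation leb := (@lebesgue_measure R).
Local Notation T := (@gaussT R).

(** The distribution function of the density [1 / (ln 2 (1 + x))] on []0, 1[]. Clamping the argument
    makes it cumulative on the whole line, with limits 0 and 1, so that the Stieltjes construction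
    yields a probability. *)
Definition gauss_cdf (x : R) : R := ln (1 + Num.min 1 (Num.max 0 x)) / ln 2.

Lemma ln2_gt0 : 0 < ln (2 : R).
Proof. by apply: ln_gt0; rewrite ltr1n. Qed.

Lemma gauss_cdf_ge0E (x : R) : 0 <= x <= 1 -> gauss_cdf x = ln (1 + x) / ln 2.
Proof. by move=> /andP[x0 x1]; rewrite /gauss_cdf max_r// min_r. Qed.

Lemma gauss_cdf_le0 (x : R) : x <= 0 -> gauss_cdf x = 0.
Proof. by move=> x0; rewrite /gauss_cdf max_l// min_r// addr0 ln1 mul0r. Qed.

Lemma gauss_cdf_ge1 (x : R) : 1 <= x -> gauss_cdf x = 1.
Proof.
move=> x1; rewrite /gauss_cdf max_r ?(le_trans _ x1)// min_l//.
by rewrite -(natrD _ 1 1) divff// gt_eqF// ln2_gt0.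
Qed.

(** The lower bound is the monotonicity needed to build the measure; the upper one, a Lipschitz
    bound from [ln (1 + y) <= y], gives right continuity and absolute continuity. *)
Lemma gauss_cdfB (a b : R) : a <= b ->
  0 <= gauss_cdf b - gauss_cdf a <= (ln 2)^-1 * (b - a).
Proof.
move=> ab; rewrite /gauss_cdf -mulrBl.
set u := Num.min 1 (Num.max 0 b); set v := Num.min 1 (Num.max 0 a).
have v0 : 0 <= v by rewrite /v le_min ler01 le_max lexx.
have uv : 0 <= u - v <= b - a.
  rewrite /u /v /Num.min /Num.max.
  by case: (ltP 0 a) => ?; case: (ltP 0 b) => ?; do ! case: ifPn; rewrite -?leNgt; lra.
have -> : ln (1 + u) - ln (1 + v) = ln (1 + (u - v) / (1 + v)).
  rewrite -ln_div ?posrE; [|lra|lra]; congr ln; field; apply/eqP; lra.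
have q0 : 0 <= (u - v) / (1 + v) by rewrite divr_ge0; lra.
have qle : (u - v) / (1 + v) <= b - a.
  by rewrite ler_pdivrMr; nra.
rewrite mulr_ge0 ?invr_ge0 ?(ltW ln2_gt0)//=; last by apply: ln_ge0; lra.
rewrite mulrC ler_pM2l ?invr_gt0 ?ln2_gt0//.
by apply: le_trans qle; apply: le_ln1Dx; lra.
Qed.

Lemma gauss_cdf_nd : {homo gauss_cdf : x y / x <= y}.
Proof. by move=> a b /gauss_cdfB/andP[]; rewrite subr_ge0. Qed.

Lemma gauss_cdf_rc : right_continuous gauss_cdf.
Proof.
move=> x; apply/cvgrPdist_le => e e0; near=> y.
have xy : x <= y by near: y; exact: nbhs_right_ge.
have /andP[h0 h1] := gauss_cdfB xy.
rewrite distrC ger0_norm//; apply: (le_trans h1).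
rewrite mulrC ler_pdivrMr ?ln2_gt0// lerBlDl.
near: y; apply: nbhs_right_le; rewrite ltrDl mulr_gt0// ln2_gt0.
Unshelve. all: by end_near. Qed.

HB.instance Definition _ := isCumulative.Build R _ R gauss_cdf gauss_cdf_nd gauss_cdf_rc.

Lemma gauss_cdfNy : gauss_cdf @ -oo --> (0 : R).
Proof.
apply: cvg_near_cst; near=> x; apply: gauss_cdf_le0.
by near: x; exact: nbhs_ninfty_le.
Unshelve. all: by end_near. Qed.

Lemma gauss_cdfy : gauss_cdf @ +oo --> (1 : R).
Proof.
apply: cvg_near_cst; near=> x; apply: gauss_cdf_ge1.
by near: x; exact: nbhs_pinfty_ge.
Unshelve. all: by end_near. Qed.

HB.instance Definition _ := isCumulativeBounded.Build R 0 1 gauss_cdf gauss_cdfNy gauss_cdfy.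

Definition gauss_measure : probability (measurableTypeR R) R :=
  lebesgue_stieltjes_measure gauss_cdf.
Local Notation P := gauss_measure.

Lemma gauss_measure_oc (a b : R) : a <= b -> P `]a, b] = (gauss_cdf b - gauss_cdf a)%:E.
Proof.
move=> ab; rewrite /P /= /lebesgue_stieltjes_measure /measure_extension.
by rewrite measurable_mu_extE/= ?wlength_itv_bnd//; exact: is_ocitv.
Qed.

(** The Gauss density is at most [1 / ln 2]. Null sets of [leb] thus become null for [P], and tails
    under [P] are controlled by lengths. *)
Lemma gauss_measure_le (A : set R) : measurable A ->
  (P A <= ((ln 2)^-1)%:E * leb A)%E.
Proof.
apply: (@measure_le_lebesgue R P) => [|a b ab]; first by rewrite invr_gt0 ln2_gt0.
apply: (@le_trans _ _ (gauss_cdf b - gauss_cdf a)%:E).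
  by rewrite le_eqVlt; apply/orP; left; apply/eqP; exact: gauss_measure_oc.
by rewrite lee_fin; have /andP[] := gauss_cdfB ab.
Qed.

Lemma gauss_measure_null (A : set R) : measurable A -> leb A = 0%E -> P A = 0%E.
Proof.
move=> mA A0; apply/eqP; rewrite eq_le measure_ge0 andbT.
by rewrite (le_trans (gauss_measure_le mA))// A0 mule0.
Qed.

Lemma gauss_measure_cc (a b : R) : a <= b -> P `[a, b] = (gauss_cdf b - gauss_cdf a)%:E.
Proof.
move=> ab; rewrite -(setU1itv false)// measureU//; last 1 first.
  by apply/seteqP; split => // x [/= ->]; rewrite in_itv/= ltxx.
transitivity (0 + (gauss_cdf b - gauss_cdf a)%:E)%E; last by rewrite add0e.
congr (_ + _)%E; last exact: gauss_measure_oc.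
by apply: gauss_measure_null => //; exact: lebesgue_measure_set1.
Qed.

Lemma gauss_measureC01 : P (~` `]0, 1[) = 0%E.
Proof.
have h : P `]0, 1] = 1%E.
  by rewrite gauss_measure_oc// (@gauss_cdf_le0 0)// gauss_cdf_ge1// subr0.
have -> : ~` `]0, 1[ = ~` `]0, 1] `|` [set (1:R)].
  apply/seteqP; split => [x|x [|->]]; rewrite /= !in_itv/=.
  - have [->|x1] := eqVneq x 1; [by right|left].
    by rewrite le_eqVlt (negbTE x1).
  - by apply: contra_not => /andP[-> /ltW].
  - by rewrite ltxx andbF.
apply: null_set_setU => //; first exact: measurableC.
  transitivity (1 - P `]0%R, 1%R])%E; last by rewrite h subee.
  exact: probability_setC.
by apply: gauss_measure_null => //; exact: lebesgue_measure_set1.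
Qed.

Lemma gauss_measureI01 (A : set R) : measurable A -> P (A `&` `]0, 1[) = P A.
Proof.
move=> mA; have m01 : measurable (`]0, 1[ : set R) by exact: measurable_itv.
rewrite [RHS](measureDI P mA m01) -[LHS]add0e; congr (_ + _)%E.
apply/esym/(@subset_measure0 _ _ _ P _ (~` `]0, 1[)); last exact: gauss_measureC01.
- exact: measurableD.
- exact: measurableC.
- by move=> x [].
Qed.

(** On []0, 1[] the integer part of [x^-1] is some [n.+1], and [T x <= r] then reads
    [n.+1 <= x^-1 <= n.+1 + r]. *)
Lemma preimage_gaussT_Nyc (r : R) : 0 <= r < 1 ->
  (T @^-1` `]-oo, r]) `&` `]0, 1[ =
  (\bigcup_n `[(n.+1%:R + r)^-1, n.+1%:R^-1]) `&` `]0, 1[.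
Proof.
move=> /andP[r0 r1]; apply/seteqP; split => x [/= Txr x01]; split => //.
- move: Txr; rewrite ?in_itv/= => Txr; rewrite in_itv/= in x01.
  have := floor_inv_ge1 x01; rewrite -[1]mulr1z ler_int.
  case E : (Num.floor x^-1) => [[|n]|]// _; exists n => //=; rewrite in_itv/=.
  have /andP[x0 x1] := x01.
  have := floor_le_tmp x^-1; move: Txr; rewrite /gaussT E -pmulrn => Txr nx.
  rewrite -[x in _ <= x <= _]invrK !lef_pV2 ?posrE ?invr_gt0//.
  + by rewrite nx andbT -lerBlDl.
  + by rewrite ltr_wpDr.
- case: Txr => n _ /=; rewrite in_itv/= in x01; rewrite ?in_itv/= => /andP[h1 h2].
  have /andP[x0 x1] := x01.
  have n0 : 0 < n.+1%:R + r by rewrite ltr_wpDr.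
  have k1 : n.+1%:R <= x^-1 by rewrite -[leLHS]invrK lef_pV2 ?posrE// invr_gt0.
  have k2 : x^-1 <= n.+1%:R + r by rewrite -[leRHS]invrK lef_pV2 ?posrE// invr_gt0.
  rewrite /gaussT (_ : Num.floor x^-1 = n.+1)//; first by rewrite lerBlDl.
  apply: floor_def; rewrite intrD -pmulrn k1/=; lra.
Qed.

(** The value comes from [1 + (n + 1 + s)^-1 = (n + 2 + s) / (n + 1 + s)] at [s = 0] and [s = r];
    differences of logarithms are kept so that the sum over [n] telescopes. *)
Lemma gauss_measure_inverse_itv (r : R) (n : nat) : 0 <= r ->
  P `[(n.+1%:R + r)^-1, n.+1%:R^-1] = (((ln n.+2%:R - ln n.+1%:R) -
    (ln (n.+2%:R + r) - ln (n.+1%:R + r))) / ln 2)%:E.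
Proof.
move=> r0; have n0 : 0 < n.+1%:R + r by rewrite ltr_wpDr.
have lnE (s : R) : 0 <= s -> gauss_cdf (n.+1%:R + s)^-1 =
    (ln (n.+2%:R + s) - ln (n.+1%:R + s)) / ln 2.
  move=> s0; have ns1 : 1 <= n.+1%:R + s by rewrite ler_wpDr// ler1n.
  rewrite gauss_cdf_ge0E; last first.
    by rewrite invr_ge0 invf_le1 ?(lt_le_trans ltr01 ns1)// ns1 andbT (le_trans ler01).
  have ns2 : 0 < n.+2%:R + s by rewrite -natr1; lra.
  rewrite -ln_div ?posrE ?(lt_le_trans ltr01 ns1)//; congr (_ / _); congr ln.
  by rewrite -natr1; field; apply/eqP; rewrite natr1; lra.
rewrite gauss_measure_cc; last by rewrite lef_pV2 ?posrE// lerDl.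
have := lnE 0 (lexx _); rewrite !addr0 => ->; rewrite lnE//.
by rewrite -mulrBl.
Qed.

Lemma gauss_measure_preimage_Nyc (r : R) : P (T @^-1` `]-oo, r]) = (gauss_cdf r)%:E.
Proof.
have mT A : measurable A -> measurable (T @^-1` A).
  by move=> mA; rewrite -[X in measurable X]setTI; exact: measurable_gaussT.
have [r0|r0] := ltP r 0.
  rewrite gauss_cdf_le0 ?ltW// (_ : _ @^-1` _ = set0) ?measure0//.
  apply/seteqP; split => // x /=; rewrite in_itv/= => Tr.
  by have /andP[/le_trans/(_ Tr)] := gaussT_itv x; rewrite leNgt r0.
have [r1|r1] := leP 1 r.
  rewrite gauss_cdf_ge1// (_ : _ @^-1` _ = setT) ?probability_setT//.
  apply/seteqP; split => // x _ /=; rewrite in_itv/=.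
  by have /andP[_ /ltW/le_trans] := gaussT_itv x; apply.
have r01 : 0 <= r < 1 by rewrite r0.
rewrite -gauss_measureI01; last by apply: mT.
rewrite preimage_gaussT_Nyc// gauss_measureI01; last exact: bigcup_measurable.
set F := fun n : nat => `[(n.+1%:R + r)^-1, n.+1%:R^-1]%classic.
(* Two of these intervals could meet only if [j.+1 <= i.+1 + r] for some [i < j], which [r < 1]
   forbids. *)
have tF : trivIset setT F.
  apply/trivIsetP => i j _ _.
  wlog ij : i j / (i < j)%N.
    move=> w; rewrite neq_ltn => /orP[ij|ji]; first by apply: w => //; rewrite neq_ltn ij.
    by rewrite setIC; apply: w => //; rewrite neq_ltn ji.
  move=> _; apply/seteqP; split => // x [].
  rewrite /F set_itvcc => /andP[h1 _]; rewrite set_itvcc => /andP[_ h2].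
  have := le_trans h1 h2; rewrite lef_pV2 ?posrE ?ltr_wpDr//; apply/negP.
  rewrite -ltNge (@lt_le_trans _ _ i.+2%:R)// ?ler_nat//.
  by rewrite -[i.+2]addn1 natrD ltrD2l.
have := @measure_semi_sigma_additive _ _ _ P F (fun=> measurable_itv _) tF
  (bigcup_measurable (fun=> fun=> measurable_itv _)).
move=> /cvg_lim <- //; apply/cvg_lim => //.
(* The telescoped partial sums; the subtracted logarithm tends to [ln 1 = 0], leaving
   [gauss_cdf r]. *)
have -> : (fun n => (\sum_(0 <= i < n) P (F i))%E) =
    EFin \o (fun n => (ln (1 + r) - ln (1 + r * n.+1%:R^-1)) / ln 2).
  apply/funext => n /=.
  have -> : 1 + r * n.+1%:R^-1 = (n.+1%:R + r) / n.+1%:R.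
    by rewrite mulrDl divff.
  rewrite ln_div ?posrE ?ltr_wpDr//.
  elim: n => [|n IH].
    by rewrite big_geq// ln1 subr0 subrr mul0r.
  rewrite big_nat_recr//= IH gauss_measure_inverse_itv// -EFinD; congr EFin.
  by rewrite -mulrDl; congr (_ / _); ring.
rewrite gauss_cdf_ge0E ?(ltW r1) ?r0//.
apply/cvg_EFin; first exact: nearW.
apply: cvgMl; rewrite -[X in _ --> X]subr0; apply: cvgB; first exact: cvg_cst.
rewrite -(ln1 R); apply: continuous_cvg; first exact: continuous_ln.
rewrite -[X in _ --> X]addr0; apply: cvgD; first exact: cvg_cst.
by rewrite -[X in _ --> X](mulr0 r); apply: cvgMr; exact: cvg_harmonic.
Qed.

Lemma gauss_measure_invariant (A : set R) : measurable A -> P (T @^-1` A) = P A.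
Proof.
move=> mA; apply/esym.
have mT B : measurable B -> measurable (T @^-1` B).
  by move=> mB; rewrite -[X in measurable X]setTI; exact: measurable_gaussT.
apply: (@lebesgue_stieltjes_measure_unique R gauss_cdf
  (pushforward P (T : R -> measurableTypeR R))) => //=.
  exact: measurable_gaussT.
move=> mT' X [[a b] _ <-] /=; rewrite /pushforward.
have [ab|ba] := leP a b; last first.
  by rewrite set_itv_ge ?preimage_set0 ?measure0// bnd_simp -leNgt ltW.
rewrite -/(P _) gauss_measure_oc//.
have -> : `]a, b]%classic = `]-oo, b] `\` `]-oo, a] :> set R.
  by rewrite -[RHS]setCK setCD setCitvl setUC -[LHS]setCK setCitv.
rewrite (_ : T @^-1` (_ `\` _) = T @^-1` `]-oo, b] `\` T @^-1` `]-oo, a])//.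
rewrite measureD ?(le_lt_trans (probability_le1 _ _)) ?ltry//;
  [|by apply: mT..].
rewrite -preimage_setI setIidr; last by apply: subset_itvl; rewrite bnd_simp.
rewrite EFinB; congr (_ - _)%E; apply/esym; exact: gauss_measure_preimage_Nyc.
Qed.

End gauss_measure.

(** * Birkhoff averages *)

Section maximal_ergodic.
Context d (X : measurableType d) (R : realType).
Variables (P : probability X R) (S : X -> X).
Hypothesis mS : measurable_fun setT S.
Hypothesis PS : forall A, measurable A -> P (S @^-1` A) = P A.

Lemma ge0_integral_invariant (f : X -> \bar R) : measurable_fun setT f ->
  (forall x, (0 <= f x)%E) -> (\int[P]_x f (S x) = \int[P]_x f x)%E.
Proof.
move=> mf f0; transitivity (\int[pushforward P S]_x f x)%E.
  by rewrite ge0_integral_pushforward.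
by apply: eq_measure_integral => A mA _; exact: PS.
Qed.

Lemma integrable_invariant (f : X -> \bar R) :
  P.-integrable setT f -> P.-integrable setT (f \o S).
Proof.
move=> /integrableP[mf fi]; apply/integrableP; split.
  exact: measurableT_comp mf mS.
by rewrite (ge0_integral_invariant (f := fun x => `|f x|%E))//; exact: measurableT_comp.
Qed.

Lemma Rintegral_invariant (g : X -> R) : P.-integrable setT (EFin \o g) ->
  \int[P]_x g (S x) = \int[P]_x g x.
Proof.
move=> ig; rewrite /Rintegral; congr fine.
transitivity (\int[pushforward P S]_x (g x)%:E)%E.
  rewrite (integral_pushforward mS (mu := P) (D := setT))//.
  - by case/integrableP: ig.
  - exact: integrable_invariant ig.
by apply: eq_measure_integral => A mA _; exact: PS.
Qed.

(** The maximum of the Birkhoff sums of [g] of lengths 0 to [n], written through the recursion on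
    which Garsia's argument rests. *)
Fixpoint orbit_max (g : X -> R) n x : R :=
  if n is n'.+1 then Num.max 0 (g x + orbit_max g n' (S x)) else 0.

Lemma orbit_max_ge0 g n x : 0 <= orbit_max g n x.
Proof. by case: n => [|n] //=; rewrite le_max lexx. Qed.

Lemma orbit_max_nd g x : {homo (fun n => orbit_max g n x) : m n / (m <= n)%N >-> m <= n}.
Proof.
apply: homo_leq => [y|y z t|n]; [exact: lexx|exact: le_trans|].
elim: n x => [|n IH] x; first exact: orbit_max_ge0.
by rewrite [X in X <= _]/= [X in _ <= X]/= ge_max !le_max lexx/= lerD2l IH orbT.
Qed.

Lemma sum_le_orbit_max g n x : \sum_(k < n) g (iter k S x) <= orbit_max g n x.
Proof.
elim: n x => [|n IH] x; first by rewrite big_ord0.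
rewrite big_ord_recl/= le_max lerD2l; apply/orP; right.
by apply: le_trans (IH _); apply: ler_sum => k _; rewrite /bump/= -iterSr.
Qed.

Lemma measurable_orbit_max g n : measurable_fun setT g ->
  measurable_fun setT (orbit_max g n).
Proof.
move=> mg; elim: n => [|n IH]; first exact: measurable_cst.
apply: measurable_maxr => //; apply: measurable_funD => //.
exact: measurableT_comp IH mS.
Qed.

Lemma integrable_orbit_max g n : P.-integrable setT (EFin \o g) ->
  P.-integrable setT (EFin \o orbit_max g n).
Proof.
move=> ig; have mg : measurable_fun setT g by apply/measurable_EFinP; case/integrableP: ig.
elim: n => [|n IH]; first exact: integrable0.
apply: le_integrable (integrableD _ ig (integrable_invariant IH)) => //.
  by apply/measurable_EFinP; exact: (measurable_orbit_max n.+1).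
move=> x _ /=; rewrite lee_fin ger0_norm ?le_max ?lexx// ge_max normr_ge0/=.
exact: ler_norm.
Qed.

(** Finiteness of the supremum of the Birkhoff sums does not depend on the first term, so this set
    is invariant at every point, not just almost everywhere, as [gaussT_ergodic] demands. *)
Definition orbit_bounded (g : X -> R) : set X :=
  [set x | exists C, forall n, orbit_max g n x <= C].

Lemma orbit_bounded_invariant g x : orbit_bounded g (S x) <-> orbit_bounded g x.
Proof.
split=> -[C hC].
- exists (Num.max 0 (g x + C)) => -[|n] /=; first by rewrite le_max lexx.
  by rewrite ge_max !le_max lexx/= lerD2l hC orbT.
- exists (C - g x) => n; rewrite lerBrDl.
  by apply: le_trans (hC n.+1); rewrite /= le_max lexx orbT.
Qed.

Lemma measurable_orbit_bounded g : measurable_fun setT g -> measurable (orbit_bounded g).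
Proof.
move=> mg; rewrite (_ : orbit_bounded g =
    \bigcup_(k : nat) \bigcap_(n : nat) (orbit_max g n @^-1` `]-oo, k%:R])).
  apply: bigcup_measurable => k _; apply: bigcapT_measurable => n.
  by rewrite -[X in measurable X]setTI; apply: measurable_orbit_max.
apply/seteqP; split => [x [C hC]|x [k _ hk]].
  exists (Num.bound `|C|) => // n _ /=; rewrite in_itv/=.
  by apply: (le_trans (hC n)); by rewrite ltW// (le_lt_trans (ler_norm _))// archi_boundP.
by exists k%:R => n; have := hk n I; rewrite /= in_itv.
Qed.

(* Garsia's argument: [M_{n+1} - M_n o S = max (- M_n o S) g] has nonnegative
   integral and tends to [g] where the [M_n] are unbounded. *)
Lemma maximal_ergodic g : P.-integrable setT (EFin \o g) ->
  P (orbit_bounded g) = 0%E -> 0 <= \int[P]_x g x.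
Proof.
move=> ig b0; have mg : measurable_fun setT g by apply/measurable_EFinP; case/integrableP: ig.
pose h n x := orbit_max g n.+1 x - orbit_max g n (S x).
have hE n x : h n x = Num.max (- orbit_max g n (S x)) (g x).
  by rewrite /h /= addr_maxl add0r addrK.
have hint n : P.-integrable setT (EFin \o h n).
  exact: integrableB (integrable_orbit_max n.+1 ig)
    (integrable_invariant (integrable_orbit_max n ig)).
have hge n : 0 <= \int[P]_x h n x.
  rewrite /h RintegralB//; [|exact: integrable_orbit_max|]; last first.
    exact: integrable_invariant (integrable_orbit_max n ig).
  rewrite (Rintegral_invariant (integrable_orbit_max n ig)) subr_ge0.
  apply: le_Rintegral => //; [exact: integrable_orbit_max..|].
  by move=> x _; exact: orbit_max_nd.
(* The exceptional set is [orbit_bounded g]: elsewhere [orbit_max g n (S x)] eventually reaches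
   [- g x], and from then on [h n x] equals [g x]. *)
have hcvg : {ae P, forall x, setT x -> (h n x)%:E @[n --> \oo] --> (g x)%:E}.
  exists (orbit_bounded g); split => //; first exact: measurable_orbit_bounded.
  move=> x /= nc; apply: contrapT => nb; apply: nc => _.
  have [n0 hn0] : exists n0, - g x <= orbit_max g n0 (S x).
    apply: contrapT => /forallNP nn; apply: nb; apply/orbit_bounded_invariant.
    by exists (- g x) => n; apply: ltW; rewrite ltNge; apply/negP.
  apply: cvg_near_cst; near=> n; rewrite hE; congr EFin; apply: max_r.
  rewrite lerNl (le_trans hn0)//; apply: orbit_max_nd.
  by near: n; exists n0.
(* Where [h n x] differs from [g x] it equals [- M] with [g x <= - M <= 0], so [g] itself
   dominates. *)
have habs : {ae P, forall x (n : nat), setT x -> (`|(h n x)%:E| <= `|(g x)%:E|)%E}.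
  apply: aeW => x n _; rewrite hE /= lee_fin.
  have := orbit_max_ge0 g n (S x); set M := orbit_max _ _ _ => M0.
  rewrite /Num.max; case: ifPn; rewrite -?leNgt => // gM.
  rewrite normrN ger0_norm// ler0_norm; lra.
have [_ _] := @dominated_convergence _ _ _ P setT measurableT (fun n => EFin \o h n)
  (EFin \o g) (abse \o (EFin \o g)) (fun n => measurable_int _ (hint n))
  (measurable_int _ ig) hcvg (integrable_abse ig) habs.
move=> lim; rewrite /Rintegral fine_ge0//.
have <- : limn (fun n => \int[P]_x (EFin \o h n) x)%E = (\int[P]_x (g x)%:E)%E.
  exact/cvg_lim.
apply: lime_ge; first by apply/cvg_ex; eexists; exact: lim.
apply: nearW => n; rewrite -[X in (_ <= X)%E]fineK ?integrable_fin_num//.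
by rewrite lee_fin; exact: hge.
Unshelve. all: by end_near. Qed.

End maximal_ergodic.

Lemma cvg_average (R : realType) (s : nat -> R) (l : R) :
  (forall j : nat, exists C, forall n, s n <= n%:R * (l + j.+1%:R^-1) + C) ->
  (forall j : nat, exists C, forall n, n%:R * (l - j.+1%:R^-1) - C <= s n) ->
  s n / n%:R @[n --> \oo] --> l.
Proof.
move=> hu hl; apply/cvgrPdist_le => e e0.
pose j := Num.bound (2 / e).
have je : j.+1%:R^-1 <= e / 2.
  rewrite -[leRHS]invrK lef_pV2 ?posrE ?invr_gt0 ?divr_gt0// invf_div.
  have : 2 / e < (Num.bound (2 / e))%:R by rewrite archi_boundP// divr_ge0// ltW.
  by move=> /lt_trans h; apply/ltW/h; rewrite ltr_nat.
have [C hC] := hu j; have [C' hC'] := hl j.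
near=> n.
have n0 : (0 : R) < n%:R by rewrite ltr0n; near: n; exists 1%N.
have hn : Num.max C C' <= n%:R * (e / 2).
  rewrite -ler_pdivrMr ?divr_gt0//; near: n; exact: nbhs_infty_ger.
move: hn; rewrite ge_max => /andP[h1 h2].
have := hC n; have := hC' n.
have {}je : n%:R * j.+1%:R^-1 <= n%:R * (e / 2) by rewrite ler_pM2l.
move=> g1 g2; rewrite -[l](mulfK (lt0r_neq0 n0)) -mulrBl normrM [`|n%:R^-1|]ger0_norm ?invr_ge0//.
rewrite ler_pdivrMr// ler_norml.
have aux (N L S e' ij c c' : R) : c <= N * (e' / 2) -> c' <= N * (e' / 2) ->
    N * ij <= N * (e' / 2) -> N * (L - ij) - c' <= S -> S <= N * (L + ij) + c ->
    - (e' * N) <= L * N - S <= e' * N.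
  by move=> *; apply/andP; split; lra.
exact: (aux _ _ _ _ _ _ _ h1 h2 je g1 g2).
Unshelve. all: by end_near. Qed.

(** * Pointwise ergodic theorem for the Gauss map and its square *)

Section gauss_birkhoff.
Context {R : realType}.
Local Notation leb := (@lebesgue_measure R).
Local Notation P := (@gauss_measure R).
Local Notation T := (@gaussT R).

Let T2 (x : R) : R := T (T x).

Lemma measurable_gaussT2 : measurable_fun setT T2.
Proof. exact: measurableT_comp (@measurable_gaussT R) (@measurable_gaussT R). Qed.

Lemma gauss_measure_invariant2 (A : set R) : measurable A -> P (T2 @^-1` A) = P A.
Proof.
move=> mA; rewrite -[RHS]gauss_measure_invariant// -[RHS]gauss_measure_invariant//.
by rewrite -[X in measurable X]setTI; exact: measurable_gaussT.
Qed.

Let bounded := @orbit_bounded _ R R T2.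

(** By ergodicity the unbounded set is null or of full measure; in the second case [maximal_ergodic]
    would contradict the sign of the integral. *)
Lemma orbit_bounded_ae (g : R -> R) : P.-integrable setT (EFin \o g) ->
  \int[P]_x g x < 0 -> {ae leb, forall x, 0 < x < 1 -> bounded g x}.
Proof.
move=> ig gneg; have mg : measurable_fun setT g by apply/measurable_EFinP; case/integrableP: ig.
have mB : measurable (bounded g) by exact: (measurable_orbit_bounded measurable_gaussT2).
have m01 : measurable (`]0, 1[ : set R) by exact: measurable_itv.
have invB x : (~` bounded g) (T (T x)) <-> (~` bounded g) x.
  by apply: not_iff_compat; exact: orbit_bounded_invariant.
case: (gaussT_ergodic (measurableC mB) invB) => [z|z].
  exists (~` bounded g `&` `]0%R, 1%R[); split => //.
    by apply: measurableI => //; exact: measurableC.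
  by move=> x /= /not_implyP[x01 nb]; split => //; rewrite in_itv.
exfalso; move: gneg; apply/negP; rewrite -leNgt.
apply: (@maximal_ergodic _ (measurableTypeR R) R P T2 measurable_gaussT2
  gauss_measure_invariant2 g ig).
rewrite -(@gauss_measureI01 R (bounded g))//.
apply: gauss_measure_null; first exact: measurableI.
by rewrite setIC -[bounded g]setCK -setDE.
Qed.

Lemma birkhoff_gaussT2 (g : R -> R) : P.-integrable setT (EFin \o g) ->
  {ae leb, forall x, 0 < x < 1 ->
    (\sum_(k < n) g (iter k T2 x)) / n%:R @[n --> \oo] --> \int[P]_x g x}.
Proof.
move=> ig; set l := \int[P]_x g x.
have icst (c : R) : P.-integrable setT (EFin \o (cst c : R -> R)).
  exact: finite_measure_integrable_cst.
have ic (c : R) : \int[P]_x (cst c x) = c.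
  rewrite Rintegral_cst// [fine _](_ : _ = 1) ?mulr1//.
  by have := @probability_setT _ _ _ P; rewrite /= => ->.
(* The slack [j.+1%:R^-1] makes the integral of the shifted function strictly negative; letting [j]
   run over the naturals keeps the exceptional set a countable union. *)
have upper j : {ae leb, forall x, 0 < x < 1 ->
    bounded (fun x => g x - cst (l + j.+1%:R^-1) x) x}.
  apply: orbit_bounded_ae; first exact: (integrableB measurableT ig (icst _)).
  by rewrite RintegralB// ic -/l opprD addrA subrr sub0r oppr_lt0 invr_gt0.
have lower j : {ae leb, forall x, 0 < x < 1 ->
    bounded (fun x => cst (l - j.+1%:R^-1) x - g x) x}.
  apply: orbit_bounded_ae; first exact: (integrableB measurableT (icst _) ig).
  by rewrite RintegralB// ic -/l addrAC subrr sub0r oppr_lt0 invr_gt0.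
apply: (negligibleS _ (negligibleU (negligible_bigcup upper) (negligible_bigcup lower))).
move=> x /= nc; apply: contrapT => /not_orP[/= nu nl]; apply: nc => x01.
apply: cvg_average => j.
- have [C hC] : bounded (fun x => g x - cst (l + j.+1%:R^-1) x) x.
    by apply: contrapT => nb; apply: nu; exists j => //= /(_ x01).
  exists C => n; have := le_trans (sum_le_orbit_max T2 _ n x) (hC n).
  by rewrite sumrB/= sumr_const card_ord -[(l + _) *+ n]mulr_natl lerBlDl.
- have [C hC] : bounded (fun x => cst (l - j.+1%:R^-1) x - g x) x.
    by apply: contrapT => nb; apply: nl; exists j => //= /(_ x01).
  exists C => n; have := le_trans (sum_le_orbit_max T2 _ n x) (hC n).
  by rewrite sumrB/= sumr_const card_ord -[(l - _) *+ n]mulr_natl lerBlDr [leRHS]addrC -lerBlDr.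
Qed.

Lemma sum_parity (s : R) (u : nat -> R) n :
  \sum_(j < n) s ^+ j * u j = \sum_(k < uphalf n) s ^+ k.*2 * u k.*2 +
                              \sum_(k < n./2) s ^+ k.*2.+1 * u k.*2.+1.
Proof.
elim: n => [|n IH]; first by rewrite !big_ord0 addr0.
rewrite big_ord_recr/= IH; have := odd_double_half n; case E : (odd n) => /= nE.
- have -> : uphalf n = n./2.+1 by rewrite uphalf_half E.
  rewrite [X in _ = _ + X]big_ord_recr/= -addrA; congr (_ + (_ + _)).
  by have -> : n./2.*2.+1 = n by rewrite -add1n.
- have -> : uphalf n = n./2 by rewrite uphalf_half E.
  rewrite [X in _ = X + _]big_ord_recr/= addrAC; congr (_ + _ + _).
  by have -> : n./2.*2 = n by rewrite -[RHS]nE add0n.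
Qed.

(** The hypothesis on [h] says that [2 h n] and [n] differ by at most 1, which covers both [uphalf]
    and [half], the numbers of even and of odd times below [n]. *)
Lemma cvg_half_nat (h : nat -> nat) (u : nat -> R) (l : R) :
  (forall n, (n <= (h n).*2.+1)%N /\ ((h n).*2 <= n.+1)%N) ->
  u n / n%:R @[n --> \oo] --> l -> u (h n) / n%:R @[n --> \oo] --> l / 2.
Proof.
move=> hb ul.
have hcvg : h n @[n --> \oo] --> \oo.
  by move=> A [N _ NA]; exists N.*2.+1 => // n /= Nn; apply: NA => /=; have [] := hb n; lia.
have half : (h n)%:R / n%:R @[n --> \oo] --> (2^-1 : R).
  apply/cvgrPdist_le => e e0; near=> n.
  have n0 : (0 : R) < n%:R by rewrite ltr0n; near: n; exists 1%N.
  have ne : 1 <= n%:R * e.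
    by rewrite -ler_pdivrMr//; near: n; exact: nbhs_infty_ger.
  rewrite -[2^-1](mulfK (lt0r_neq0 n0)) -mulrBl normrM [`|n%:R^-1|]ger0_norm ?invr_ge0//.
  rewrite ler_pdivrMr// ler_norml.
  have h1 : n%:R <= 2 * (h n)%:R + 1 :> R.
    by have [+ _] := hb n; rewrite -(ler_nat R) -natr1 -mul2n natrM.
  have h2 : 2 * (h n)%:R <= n%:R + 1 :> R.
    by have [_] := hb n; rewrite -(ler_nat R) -natr1 -mul2n natrM.
  have aux (N H e' : R) : N <= 2 * H + 1 -> 2 * H <= N + 1 -> 1 <= N * e' ->
      - (e' * N) <= 2^-1 * N - H <= e' * N.
    by move=> *; apply/andP; split; lra.
  exact: aux.
have -> : l / 2 = 2^-1 * l by rewrite mulrC.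
have : (h n)%:R / n%:R * (u (h n) / (h n)%:R) @[n --> \oo] --> 2^-1 * l.
  by apply: cvgM => //; exact: (cvg_comp _ _ hcvg ul).
apply: cvg_trans; apply: near_eq_cvg; near=> n.
have hn0 : (h n)%:R != 0 :> R.
  rewrite pnatr_eq0 -lt0n; have [+ _] := hb n; have : (1 < n)%N by near: n; exists 2%N.
  lia.
have n0 : n%:R != 0 :> R by rewrite pnatr_eq0 -lt0n; near: n; exists 1%N.
by field; rewrite hn0 n0.
Unshelve. all: by end_near. Qed.

Lemma iter_gaussT2 k (x : R) : iter k T2 x = iter k.*2 T x.
Proof. by elim: k => //= k ->. Qed.

(** Even times form an orbit sum of [g] under [T2], odd times one of [g \o T], with the same
    integral by invariance. Each class contributes half the mean: the halves add up or cancel. *)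
Lemma birkhoff_gaussT (g : R -> R) : P.-integrable setT (EFin \o g) ->
  {ae leb, forall x, 0 < x < 1 ->
    (\sum_(j < n) g (iter j T x)) / n%:R @[n --> \oo] --> \int[P]_x g x /\
    (\sum_(j < n) (-1) ^+ j * g (iter j T x)) / n%:R @[n --> \oo] --> (0 : R)}.
Proof.
move=> ig.
have igT : P.-integrable setT (EFin \o (g \o T)).
  exact: (@integrable_invariant _ (measurableTypeR R) R P T
    (@measurable_gaussT R) (@gauss_measure_invariant R) _ ig).
have IE : \int[P]_x (g \o T) x = \int[P]_x g x.
  exact: (@Rintegral_invariant _ (measurableTypeR R) R P T
    (@measurable_gaussT R) (@gauss_measure_invariant R) _ ig).
apply: (negligibleS _ (negligibleU (birkhoff_gaussT2 ig) (birkhoff_gaussT2 igT))).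
move=> x /= nc; apply: contrapT => /not_orP[/contrapT h1 /contrapT h2]; apply: nc => x01.
have {}h1 := @cvg_half_nat uphalf _ _ (fun n => _) (h1 x01).
have {}h2 := @cvg_half_nat half _ _ (fun n => _) (h2 x01).
have {}h1 := h1 ltac:(by move=> n; have := odd_double_half n; rewrite uphalf_half; lia).
have {}h2 := h2 ltac:(by move=> n; have := odd_double_half n; lia).
rewrite IE in h2.
have gE k : g (iter k T2 x) = g (iter k.*2 T x) by rewrite iter_gaussT2.
have gTE k : g (T (iter k T2 x)) = g (iter k.*2.+1 T x) by rewrite iter_gaussT2.
split.
- have -> : (fun n => (\sum_(j < n) g (iter j T x)) / n%:R) =
    (fun n => (\sum_(k < uphalf n) g (iter k T2 x)) / n%:R +
              (\sum_(k < n./2) (g \o T) (iter k T2 x)) / n%:R).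
    apply/funext => n; rewrite -mulrDl; congr (_ / _).
    have := sum_parity 1 (fun j => g (iter j T x)) n.
    under eq_bigr do rewrite expr1n mul1r; move=> ->.
    by congr (_ + _); apply: eq_bigr => k _; rewrite expr1n mul1r -?gE -?gTE.
  by rewrite [X in _ --> X](splitr); apply: cvgD.
- have -> : (fun n => (\sum_(j < n) (-1) ^+ j * g (iter j T x)) / n%:R) =
    (fun n => (\sum_(k < uphalf n) g (iter k T2 x)) / n%:R -
              (\sum_(k < n./2) (g \o T) (iter k T2 x)) / n%:R).
    apply/funext => n; rewrite -mulrBl; congr (_ / _).
    rewrite (sum_parity (-1) (fun j => g (iter j T x)) n) -sumrN.
    congr (_ + _); apply: eq_bigr => k _.
      by rewrite -signr_odd odd_double expr0 mul1r gE.
    by rewrite -signr_odd /= odd_double expr1 mulN1r /= gTE.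
  by have := cvgB h1 h2; rewrite subrr; apply.
Qed.

End gauss_birkhoff.

(** * Integrals over blocks *)

Section integrals.
Context {R : realType}.
Local Notation leb := (@lebesgue_measure R).
Local Notation P := (@gauss_measure R).
Local Notation T := (@gaussT R).

Lemma measurable_itv_if (a b : R) (k : R -> R) : measurable_fun setT k ->
  measurable_fun setT (fun e => if a <= e < b then k e else 0).
Proof.
move=> mk; apply: measurable_fun_ifT => //; apply: measurable_and.
  by apply: measurable_fun_ler.
by apply: measurable_fun_ltr.
Qed.

Definition inv_window (a b e : R) : R := if a <= e < b then e^-1 else 0.

Lemma integral_inv_window (a b : R) : 0 < a -> a <= b ->
  (\int[leb]_e (inv_window a b e)%:E = (ln b - ln a)%:E)%E.
Proof.
move=> a0; rewrite le_eqVlt => /predU1P[->|ab].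
  rewrite subrr integral0_eq// => e _; rewrite /inv_window.
  by case: ifP => // /andP[/le_lt_trans h /h]; rewrite ltxx.
transitivity (\int[leb]_(e in `[a, b[) (e^-1)%:E)%E.
  rewrite [RHS]integral_mkcond; apply: eq_integral => e _.
  rewrite patchE /inv_window; case: ifPn => [eab|]; first by rewrite mem_set//= in_itv.
  by move=> h; rewrite memNset//= in_itv/=; exact/negP.
rewrite integral_itv_bndo_bndc; last first.
  by apply/measurable_EFinP; apply: measurable_funTS; exact: measurable_invr.
rewrite EFinB; apply: continuous_FTC2 => //.
- apply: continuous_in_subspaceT => x; rewrite inE/= in_itv/= => /andP[ax _].
  by apply: inv_continuous; rewrite gt_eqF// (lt_le_trans a0).
- have cl (x : R) : a <= x -> {for x, continuous (@ln R)}.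
    by move=> ax; apply: continuous_ln; exact: lt_le_trans ax.
  split.
  + move=> x; rewrite in_itv/= => /andP[ax _].
    by apply: ex_derive; apply: is_derive1_ln; exact: lt_trans ax.
  + by apply: cvg_at_right_filter; exact: cl.
  + by apply: cvg_at_left_filter; apply: cl; exact: ltW.
- move=> x; rewrite in_itv/= => /andP[ax _]; rewrite derive1E.
  by apply: derive_val; apply: is_derive1_ln; exact: lt_trans ax.
Qed.

Lemma block_integrable (k : R -> R) (M a b : R) : measurable_fun setT k ->
  0 < a -> a <= b -> (forall e, `|k e| <= M * inv_window a b e) ->
  leb.-integrable setT (EFin \o k) /\ `|\int[leb]_e k e| <= M * (ln b - ln a).
Proof.
move=> mk a0 ab kM.
have w0 e : 0 <= inv_window a b e.
  rewrite /inv_window; case: ifP => // /andP[ae _].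
  by rewrite invr_ge0 (le_trans (ltW a0)).
have mw : measurable_fun setT (inv_window a b).
  by apply: measurable_itv_if; exact: measurable_invr.
have iw : leb.-integrable setT (EFin \o inv_window a b).
  apply/integrableP; split; first exact/measurable_EFinP.
  under eq_integral do rewrite /= ger0_norm//.
  by rewrite integral_inv_window// ltry.
have iMw : leb.-integrable setT (EFin \o (fun e => M * inv_window a b e)).
  by have := integrableZl measurableT M iw.
have ik : leb.-integrable setT (EFin \o k).
  apply: le_integrable iMw => //; first exact/measurable_EFinP.
  by move=> e _ /=; rewrite lee_fin (le_trans (kM e))// ler_norm.
split => //; apply: (le_trans (le_normr_Rintegral _ ik)) => //.
apply: (@le_trans _ _ (\int[leb]_e (M * inv_window a b e))).
  by apply: le_Rintegral => //; exact: (integrable_abse ik).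
by rewrite RintegralZl// /Rintegral integral_inv_window.
Qed.

(** Lebesgue measure pushed forward by multiplication by [c] and then multiplied by [c] agrees with
    itself on intervals, hence everywhere. *)
Lemma ge0_integral_scale (f : R -> \bar R) (c : R) : 0 < c ->
  measurable_fun setT f -> (forall x, (0 <= f x)%E) ->
  (\int[leb]_x f x = \int[leb]_x (c%:E * f (c * x)%R))%E.
Proof.
move=> c0 mf f0.
have mc : measurable_fun setT ( *%R c : R -> measurableTypeR R).
  exact: mulrl_measurable.
rewrite ge0_integralZl//; [|exact: measurableT_comp mf mc|by rewrite lee_fin ltW].
unshelve refine (@etrans _ _ (\int[mscale (NngNum (ltW c0))
  (pushforward leb ( *%R c : R -> measurableTypeR R))]_x f x)%E _ _ _); first exact: mc.
all: swap 1 2.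
  by rewrite ge0_integral_mscale// ge0_integral_pushforward.
apply: eq_measure_integral => A mA _.
apply: lebesgue_measure_unique => // _ [[a b] _ <-] /=.
rewrite /mscale /= /pushforward.
have -> : *%R c @^-1` `]a, b] = `]a / c, b / c]%classic :> set R.
  apply/seteqP; split => x /=; rewrite !in_itv/= ltr_pdivrMr// ler_pdivlMr//;
  by rewrite mulrC.
rewrite !lebesgue_measure_itv/= !lte_fin ltr_pM2r ?invr_gt0//.
case: ifP => _; last by rewrite mule0.
by rewrite -!EFinD -EFinM -mulrBl mulrCA divff ?mulr1// gt_eqF.
Qed.

Lemma Rintegral_scale (k : R -> R) (c : R) : 0 < c -> measurable_fun setT k ->
  \int[leb]_x k x = \int[leb]_x (c * k (c * x)).
Proof.
move=> c0 mk; rewrite /Rintegral; congr fine.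
have mk' : measurable_fun setT (EFin \o k) by exact/measurable_EFinP.
rewrite [LHS]integralE [RHS]integralE; congr (_ - _)%E.
  rewrite (ge0_integral_scale c0) => [|//|//]; last exact: measurable_funepos.
  apply: eq_integral => x _; rewrite !funeposE -!EFin_max -EFinM.
  by rewrite maxr_pMr ?mulr0// ltW.
rewrite (ge0_integral_scale c0) => [|//|//]; last exact: measurable_funeneg.
apply: eq_integral => x _; rewrite !funenegE -!EFinN -!EFin_max -EFinM.
by rewrite maxr_pMr ?mulr0 ?mulrN// ltW.
Qed.

(** The tail of [- ln] at [r] is the measure of [x < expR (- r)], at most [expR (- r) / ln 2]; the
    integral of the tails is then at most [1 / ln 2] times that of an exponential density. *)
Lemma integrable_ln_gauss : P.-integrable setT (EFin \o (@ln R)).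
Proof.
(* Truncation off []0, 1[], a [P]-null change, makes the variable nonnegative everywhere, as the
   tail formula requires. *)
pose X (x : R) : R := if 0 < x < 1 then - ln x else 0.
have mX : measurable_fun setT (X : measurableTypeR R -> R).
  apply: measurable_fun_ifT => //.
    by apply: measurable_and; apply: measurable_fun_ltr.
  exact: measurable_funN (@measurable_ln R).
have X0 x : 0 <= X x.
  by rewrite /X; case: ifP => // /ln_lt0; rewrite oppr_ge0 => /ltW.
apply/integrableP; split; first by apply/measurable_EFinP; exact: measurable_ln.
have -> : (\int[P]_x `|(EFin \o @ln R) x| = \int[P]_x (X x)%:E)%E.
  apply: ae_eq_integral => //.
  - apply: measurableT_comp => //; apply/measurable_EFinP; exact: measurable_ln.
  - exact/measurable_EFinP.
  - exists (~` `]0, 1[); split; [exact: measurableC|exact: gauss_measureC01|].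
    move=> x /= nx x01; apply: nx => _; rewrite /X; rewrite in_itv/= in x01.
    by rewrite x01 ltr0_norm// ln_lt0.
pose Xm : {RV P >-> R} := HB.pack X (isMeasurableFun.Build _ _ _ _ _ mX).
have -> : (\int[P]_x (X x)%:E = 'E_P[Xm])%E by rewrite unlock.
rewrite ge0_expectation_ccdf//.
apply: (@le_lt_trans _ _ (\int[leb]_(r in `[0%R, +oo[)
  (((ln 2)^-1)%:E * (exponential_pdf 1 r)%:E))%E).
  apply: ge0_le_integral => //.
  - by apply: measurable_funTS; exact: ccdf_measurable.
  - apply: measurable_funeM; apply: measurable_funTS; apply/measurable_EFinP.
    exact: measurable_exponential_pdf.
  - move=> r; rewrite /= in_itv/= andbT => r0.
    have mI : measurable (`]0, expR (- r)] : set R) by exact: measurable_itv.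
    apply: (@le_trans _ _ (P `]0%R, expR (- r)])).
      apply: le_measure; rewrite ?inE//.
        by apply: (measurable_funPTI Xm); exact: measurable_itv.
      move=> x /=; rewrite in_itv/= andbT /Xm/= /X; case: ifPn => [/andP[x0 x1]|_].
        rewrite in_itv/= x0/= => h; have {1}<- : expR (ln x) = x by rewrite lnK.
        by rewrite ler_expR lerNr ltW.
      by rewrite ltNge r0.
    apply: (le_trans (gauss_measure_le mI)).
    rewrite lee_pmul2l ?lte_fin ?invr_gt0 ?ln2_gt0//.
    rewrite lebesgue_measure_itv/= lte_fin expR_gt0 oppr0 adde0 lee_fin.
    by rewrite exponential_pdfE// mul1r mulN1r.
rewrite ge0_integralZl//.
- apply: lte_mul_pinfty => //; first by rewrite lee_fin invr_ge0 ltW// ln2_gt0.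
  apply: (@le_lt_trans _ _ (\int[leb]_r (exponential_pdf (1:R) r)%:E)%E).
    apply: ge0_subset_integral => //; first by
      apply/measurable_EFinP; exact: measurable_exponential_pdf.
    by move=> r _; rewrite lee_fin exponential_pdf_ge0.
  by rewrite integral_exponential_pdf// ltry.
- by apply: measurable_funTS; apply/measurable_EFinP; exact: measurable_exponential_pdf.
- by move=> r _; rewrite lee_fin exponential_pdf_ge0.
- by rewrite lee_fin invr_ge0 ltW// ln2_gt0.
Qed.

End integrals.

(** * From averages in n to averages in ln (1/eta) *)

Section time_change.
Context {R : realType}.

Lemma cvg_natV : (n%:R : R)^-1 @[n --> \oo] --> (0 : R).
Proof.
by rewrite -(cvg_shiftS (fun n => (n%:R : R)^-1)); exact: cvg_harmonic.
Qed.

Lemma cvg_ratio_shift (m : nat) : (n%:R : R) / (n + m)%:R @[n --> \oo] --> (1 : R).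
Proof.
have h : 1 - m%:R * ((n + m)%:R : R)^-1 @[n --> \oo] --> (1 : R).
  rewrite -[X in _ --> X]subr0 -[X in _ - X](mulr0 m%:R).
  apply: cvgB; first exact: cvg_cst.
  apply: cvgMr; exact: (cvg_comp _ _ (cvg_addnr m) cvg_natV).
apply: cvg_trans h; apply: near_eq_cvg; near=> n.
have nm : (n + m)%:R != 0 :> R.
  by rewrite pnatr_eq0 -lt0n ltn_addr//; near: n; exists 1%N.
by rewrite natrD in nm *; field.
Unshelve. all: by end_near. Qed.

Lemma cvg_average_shift (m : nat) (u : nat -> R) (l : R) :
  u (n + m)%N / n%:R @[n --> \oo] --> l -> u n / n%:R @[n --> \oo] --> l.
Proof.
move=> ul; rewrite -(cvg_shiftn m) -[l]mulr1.
apply: cvg_trans (cvgM ul (cvg_ratio_shift m)); apply: near_eq_cvg; near=> n.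
have n0 : n%:R != 0 :> R by rewrite pnatr_eq0 -lt0n; near: n; exists 1%N.
have nm : (n + m)%:R != 0 :> R.
  by rewrite pnatr_eq0 -lt0n ltn_addr// lt0n -(pnatr_eq0 R).
by rewrite /= natrD in nm *; field; rewrite n0 nm.
Unshelve. all: by end_near. Qed.

(** Used with the logarithms of the distances: the block that contains [eta] has logarithmic length
    [o(n)]. *)
Lemma cvg_average_term (u : nat -> R) (l : R) : u n / n%:R @[n --> \oo] --> l ->
  (u n.+1 - u n) / n.+1%:R @[n --> \oo] --> (0 : R).
Proof.
move=> ul.
have ul1 : u n.+1 / n.+1%:R @[n --> \oo] --> l by rewrite (cvg_shiftS (fun n => u n / n%:R)).
have h : u n.+1 / n.+1%:R - u n / n%:R * (n%:R / (n + 1)%:R) @[n --> \oo] --> (0 : R).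
  have := cvgB ul1 (cvgM ul (cvg_ratio_shift 1)).
  by rewrite mulr1 subrr; apply.
apply: cvg_trans h; apply: near_eq_cvg; near=> n.
have n0 : n%:R != 0 :> R by rewrite pnatr_eq0 -lt0n; near: n; exists 1%N.
by rewrite /= mulrA divfK// addn1 mulrBl.
Unshelve. all: by end_near. Qed.

(** The chain is [|I| <= |A| + M b <= (e l / 2) N <= e B <= e t]; the factor 2 in the hypothesis
    pays for replacing [N + 1] by [N]. *)
Lemma time_change_bound (M l A B b e N I t : R) : 0 < l -> 0 <= M -> 0 < N ->
  0 <= b -> 0 < e ->
  l / 2 <= B / N -> `|A / N| + 2 * M * b / (N + 1) <= e * l / 2 -> 1 <= N ->
  `|I - A| <= M * b -> B <= t -> `|I| <= e * t.
Proof.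
move=> l0 M0 N0 b0 e0 hB hA N1 hI Bt.
rewrite ler_pdivlMr// in hB.
have hA' : `|A| / N + M * b / N <= e * l / 2.
  apply: le_trans hA; rewrite normrM normfV (gtr0_norm N0) lerD2l.
  rewrite ler_pdivrMr// mulrAC ler_pdivlMr; last by lra.
  have := mulr_ge0 M0 b0; nra.
have hI' : `|I| <= `|A| + M * b.
  by rewrite -[I](subrK A) addrC (le_trans (ler_normD _ _))// lerD2l.
apply: (le_trans hI'); rewrite -mulrDl ler_pdivrMr// in hA'.
apply: (le_trans hA'); nra.
Qed.

Lemma cvg_time_change (I : R -> R) (A_ D : nat -> R) (A l M : R) :
  0 < l -> 0 <= M -> D 0%N = 1 -> (forall n, 0 < D n) -> (forall n, D n.+1 < D n) ->
  (forall eta, 0 < eta -> exists n, D n <= eta) ->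
  - ln (D n) / n%:R @[n --> \oo] --> l -> A_ n / n%:R @[n --> \oo] --> A ->
  (forall eta n, D n.+1 <= eta < D n ->
     `|I eta - A_ n| <= M * (ln (D n) - ln (D n.+1))) ->
  (ln eta^-1)^-1 * I eta @[eta --> 0^'+] --> A / l.
Proof.
move=> l0 M0 D0 Dgt0 Dlt Dex Bl Al hI.
(* The expected main term [A / l * ln eta^-1] is subtracted, so that a limit 0 remains to be shown;
   within one block this term moves by at most [|A / l|] times the block length, whence [C]. *)
set C := M + `|A / l|.
have C0 : 0 <= C by rewrite addr_ge0.
have bl : (ln (D n) - ln (D n.+1)) / n.+1%:R @[n --> \oo] --> (0 : R).
  by have := cvg_average_term Bl; under eq_fun do rewrite opprK addrC.
have rl : `|A_ n / n%:R - A / l * (- ln (D n) / n%:R)| +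
    2 * C * ((ln (D n) - ln (D n.+1)) / n.+1%:R) @[n --> \oo] --> (0 : R).
  rewrite -[X in _ --> X]addr0 -[X in _ --> _ + X](mulr0 (2 * C)).
  apply: cvgD; last by apply: cvgMr.
  have h : A_ n / n%:R - A / l * (- ln (D n) / n%:R) @[n --> \oo] --> A - A / l * l.
    by apply: cvgB => //; apply: cvgMr.
  rewrite divfK ?subrr ?gt_eqF// in h.
  by have := cvg_norm h; rewrite normr0; apply.
apply/cvgrPdist_le => e e0.
have [n1 _ H1] : \forall n \near \oo, `|A_ n / n%:R - A / l * (- ln (D n) / n%:R)| +
    2 * C * ((ln (D n) - ln (D n.+1)) / n.+1%:R) <= e * l / 2.
  by apply: (cvgr_le _ rl); rewrite divr_gt0// mulr_gt0.
have [n2 _ H2] : \forall n \near \oo, l / 2 <= - ln (D n) / n%:R.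
  by apply: (cvgr_ge _ Bl); rewrite ltr_pdivrMr// ltr_pMr// ltr1n.
have Dnd : {homo D : i j / (i <= j)%N >-> j <= i}.
  by apply/nonincreasing_seqP => n; exact: ltW.
near=> eta.
have eta0 : 0 < eta by near: eta; exact: nbhs_right_gt.
have eta1 : eta < D (maxn 1 (maxn n1 n2)) by near: eta; exact: nbhs_right_lt.
case: (@ex_minnP (fun n => D n <= eta)) => [|n Dn nmin]; first exact: Dex.
have nN : (maxn 1 (maxn n1 n2) < n)%N.
  by rewrite ltnNge; apply/negP => /Dnd/le_trans/(_ Dn); rewrite leNgt eta1.
case: n Dn nmin nN => // n Dn nmin nN.
have etaD : eta < D n.
  by rewrite ltNge; apply/negP => /nmin; rewrite ltnn.
move: nN; rewrite ltnS !geq_max => /and3P[nge1 nn1 nn2].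
have n0 : 0 < n%:R :> R by rewrite ltr0n.
have b0 : 0 <= ln (D n) - ln (D n.+1) by rewrite subr_ge0 ler_ln ?posrE// ltW.
have tB : - ln (D n) <= ln eta^-1.
  by rewrite lnV ?posrE// lerN2 ler_ln ?posrE// ltW.
have tB' : ln eta^-1 <= - ln (D n.+1).
  by rewrite lnV ?posrE// lerN2 ler_ln ?posrE.
have t0 : 0 < ln eta^-1.
  rewrite lnV ?posrE// oppr_gt0 ln_lt0// eta0/= (lt_le_trans etaD)// -D0.
  exact: Dnd.
have -> : A / l - (ln eta^-1)^-1 * I eta = - ((I eta - A / l * ln eta^-1) / ln eta^-1).
  rewrite mulrBl mulfK ?gt_eqF//; ring.
rewrite normrN normrM normfV [`|ln _|]gtr0_norm// ler_pdivrMr//.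
apply: (@time_change_bound C l (A_ n - A / l * (- ln (D n))) (- ln (D n))
  (ln (D n) - ln (D n.+1)) e n%:R) => //.
- exact: H2.
- have := H1 n nn1; rewrite /= natr1; apply: le_trans; rewrite mulrA lerD2r.
  by rewrite mulrBl mulrA.
- by rewrite ler1n.
- have h := hI eta n; rewrite etaD Dn in h; have {}h := h isT.
  have -> : I eta - A / l * ln eta^-1 - (A_ n - A / l * - ln (D n)) =
    (I eta - A_ n) - A / l * (ln eta^-1 - - ln (D n)) by ring.
  apply: (le_trans (ler_normB _ _)); rewrite /C mulrDl lerD// normrM.
  apply: ler_pM => //; rewrite ger0_norm ?subr_ge0//; lra.
Unshelve. all: by end_near. Qed.

End time_change.

(** * Blocks as Birkhoff sums *)

Section orbit_log.
Context {R : realType}.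
Local Notation T := (@gaussT R).

Lemma ln_orbit_prodS (x : R) n : regular x ->
  ln (orbit_prod x n.+1) = ln (orbit_prod x n) + ln (iter n T x).
Proof.
move=> xr; rewrite orbit_prodS lnM ?posrE//; first exact: orbit_prod_gt0.
by have /andP[] := xr n.
Qed.

Lemma ln_orbit_prod (x : R) n : regular x ->
  ln (orbit_prod x n) = \sum_(k < n) ln (iter k T x).
Proof.
move=> xr; elim: n => [|n IH]; first by rewrite orbit_prod0 ln1 big_ord0.
by rewrite ln_orbit_prodS// IH big_ord_recr.
Qed.

Lemma orbit_prod_small (x eta : R) : regular x -> 0 < eta ->
  exists n, orbit_prod x n <= eta.
Proof.
move=> xr eta0; pose n := Num.bound eta^-1; exists n.*2.
apply: (le_trans (orbit_prod_le n xr)).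
rewrite -[leRHS]invrK exprVn lef_pV2 ?posrE ?invr_gt0 ?exprn_gt0//.
have h : eta^-1 < n%:R by apply: archi_boundP; rewrite invr_ge0 ltW.
by rewrite (le_trans (ltW h))// -natrX ler_nat ltnW// ltn_expl.
Qed.

Lemma orbit_prod_nd (x : R) : regular x ->
  {homo orbit_prod x : i j / (i <= j)%N >-> j <= i}.
Proof. by move=> xr; apply/nonincreasing_seqP => n; exact/ltW/orbit_prodS_lt. Qed.

Lemma cf_N_eq (x e : R) n : regular x ->
  orbit_prod x n.+1 <= e < orbit_prod x n -> cf_N x e = n.+1.
Proof.
move=> xr /andP[h1 h2]; rewrite /cf_N; case: pselect => [H|[]]; last first.
  by exists n.+1; rewrite cf_dE.
case: ex_minnP => k; rewrite cf_dE// => hk kmin; apply/eqP; rewrite eqn_leq.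
rewrite kmin ?cf_dE//= ltnNge; apply/negP => /(orbit_prod_nd xr)/le_trans/(_ hk).
by rewrite leNgt h2.
Qed.

Lemma block_exists (x e : R) : regular x -> 0 < e < 1 ->
  exists n, orbit_prod x n.+1 <= e < orbit_prod x n.
Proof.
move=> xr /andP[e0 e1].
case: (@ex_minnP (fun n => orbit_prod x n <= e)) => [|[|n] hn nmin].
- exact: orbit_prod_small.
- by move: hn; rewrite orbit_prod0 leNgt e1.
- by exists n; rewrite hn/= ltNge; apply/negP => /nmin; rewrite ltnn.
Qed.

(** Halving at every second step bounds the rate below by [ln 2 / 2]. This is how the denominator of
    the limit is seen to be positive. *)
Lemma orbit_rate_gt0 (x l : R) : regular x ->
  - ln (orbit_prod x n) / n%:R @[n --> \oo] --> l -> 0 < l.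
Proof.
move=> xr xl; apply: (@lt_le_trans _ _ (ln 2 / 2)); first by rewrite divr_gt0// ln2_gt0.
have xl2 : - ln (orbit_prod x n.*2) / n.*2%:R @[n --> \oo] --> l.
  have d : n.*2 @[n --> \oo] --> \oo.
    by move=> A [N _ NA]; exists N => // n /= Nn; apply: NA => /=; lia.
  exact: (cvg_comp _ _ d xl).
rewrite -(cvg_lim _ xl2)//; apply: limr_ge; first by apply/cvg_ex; exists l.
near=> n.
have n0 : 0 < n%:R :> R by rewrite ltr0n; near: n; exists 1%N.
have D0 := orbit_prod_gt0 n.*2 xr.
have h : ln (orbit_prod x n.*2) <= - (n%:R * ln 2).
  have := orbit_prod_le n xr; rewrite -ler_ln ?posrE ?exprn_gt0 ?invr_gt0//.
  by rewrite lnXn ?invr_gt0// lnV ?posrE// mulNrn mulr_natl.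
have -> : n.*2%:R = 2 * n%:R :> R by rewrite -mul2n natrM.
rewrite ler_pdivlMr ?mulr_gt0//.
have -> : ln 2 / 2 * (2 * n%:R) = n%:R * ln 2 :> R by field.
by rewrite lerNr.
Unshelve. all: by end_near. Qed.

End orbit_log.

Section blocks.
Context {R : realType} (m : nat) (f0 : m.+1.-tuple R -> R) (M : R).
Hypothesis mf0 : measurable_fun setT f0.
Hypothesis f0M : forall x, `|f0 x| <= M.
Local Notation leb := (@lebesgue_measure R).
Local Notation P := (@gauss_measure R).
Local Notation T := (@gaussT R).

Definition block_vec (D : nat -> R) n (e : R) : m.+1.-tuple R :=
  [tuple D (n - i)%N / e | i < m.+1].

(** On this window [cf_N] is [n.+1], hence the index of the vector. The sequence [D] is a parameter
    so that the products of [x] and those of a later orbit point fit the same formula. *)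
Definition block (D : nat -> R) n (e : R) : R :=
  if D n.+1 <= e < D n then f0 (block_vec D n.+1 e) / e else 0.

Lemma bound_ge0 : 0 <= M.
Proof. exact: le_trans (f0M [tuple 0 | i < m.+1]). Qed.

Lemma measurable_block (D : nat -> R) n : measurable_fun setT (block D n).
Proof.
apply: measurable_itv_if; apply: measurable_funM; last exact: measurable_invr.
apply: measurableT_comp mf0 _; apply/measurable_fun_tnthP => i.
rewrite (_ : _ \o _ = fun e => D (n.+1 - i)%N * e^-1); last first.
  by apply/funext => e /=; rewrite tnth_mktuple.
by apply: measurable_funM => //; exact: measurable_invr.
Qed.

Lemma block_bound (D : nat -> R) n a b e : 0 < a -> a <= D n.+1 -> D n <= b ->
  `|block D n e| <= M * inv_window a b e.
Proof.
move=> a0 aD Db; rewrite /block /inv_window.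
have M0 := bound_ge0.
case: ifPn => [/andP[h1 h2]|_].
  rewrite (le_trans aD h1) (lt_le_trans h2 Db)/=.
  have e0 : 0 < e := lt_le_trans a0 (le_trans aD h1).
  by rewrite normrM normfV (gtr0_norm e0) ler_pM2r ?invr_gt0.
rewrite normr0; case: ifPn => [/andP[h1 h2]|_]; last by rewrite mulr0.
by rewrite mulr_ge0// invr_ge0 (le_trans (ltW a0)).
Qed.

Lemma integral_block (x : R) n : regular x ->
  leb.-integrable setT (EFin \o block (orbit_prod x) n) /\
  `|\int[leb]_e block (orbit_prod x) n e| <=
    M * (ln (orbit_prod x n) - ln (orbit_prod x n.+1)).
Proof.
move=> xr; apply: block_integrable; first exact: measurable_block.
- exact: orbit_prod_gt0.
- exact/ltW/orbit_prodS_lt.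
- by move=> e; apply: block_bound => //; exact: orbit_prod_gt0.
Qed.

(** The function [F] of the overview. The guard sets it to 0 at points where the product vanishes or
    is negative, so that the bound by [M * |ln (T^m x)|] holds at every [x] and not only at regular
    ones. *)
Definition block_fun (x : R) : R :=
  \int[leb]_u (if 0 < orbit_prod x m.+1 then block (orbit_prod x) m u else 0).

(* Rescaling [e] by [d_j] turns the block [d_{j+m+1} <= e < d_{j+m}] of [x] into
   the block of index [m] of [T^j x], which only involves positive indices. *)
Lemma integral_block_shift (x : R) j : regular x ->
  \int[leb]_e block (orbit_prod x) (j + m) e = block_fun (iter j T x).
Proof.
move=> xr; have c0 := orbit_prod_gt0 j xr.
have c0' : orbit_prod x j != 0 by rewrite gt_eqF.
have yr := regular_gaussT j xr.
rewrite /block_fun orbit_prod_gt0//.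
rewrite [RHS](@Rintegral_scale _ (block (orbit_prod (iter j T x)) m) (orbit_prod x j)^-1)
  ?invr_gt0//; last exact: measurable_block.
apply: eq_Rintegral => e _.
have kE k : orbit_prod x (j + k) = orbit_prod x j * orbit_prod (iter j T x) k.
  exact: orbit_prodD.
rewrite /block -addnS !kE ler_pdivlMl// ltr_pdivrMl//.
case: ifP => _; last by rewrite mulr0.
have [->|e0] := eqVneq e 0; first by rewrite mulr0 !invr0 !mulr0.
rewrite (_ : block_vec (orbit_prod (iter j T x)) m.+1 ((orbit_prod x j)^-1 * e) =
  block_vec (orbit_prod x) (j + m.+1) e).
  by field; rewrite e0 c0'.
apply: eq_from_tnth => i; rewrite !tnth_mktuple -addnBA; last exact/ltnW/ltn_ord.
by rewrite kE; field; rewrite e0 c0'.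
Qed.

Lemma measurable_orbit_prod n : measurable_fun setT (fun x : R => orbit_prod x n).
Proof.
elim: n => [|n IH].
  by under eq_fun do rewrite orbit_prod0; exact: measurable_cst.
under eq_fun do rewrite orbit_prodS.
by apply: measurable_funM => //; exact: measurable_iter_gaussT.
Qed.

(** A parametric integral: the integrand is jointly measurable in [x] and [u], and Tonelli's theorem
    applies to its positive and negative parts separately. *)
Lemma measurable_block_fun : measurable_fun setT block_fun.
Proof.
pose G (z : R * R) : R := if 0 < orbit_prod z.1 m.+1 then block (orbit_prod z.1) m z.2 else 0.
have mD n : measurable_fun setT (fun z : R * R => orbit_prod z.1 n).
  exact: measurableT_comp (measurable_orbit_prod n) measurable_fst.
have mi : measurable_fun setT (fun z : R * R => z.2^-1).
  exact: measurableT_comp measurable_invr measurable_snd.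
have mG : measurable_fun setT G.
  apply: measurable_fun_ifT => //; first by apply: measurable_fun_ltr.
  apply: measurable_fun_ifT => //.
    by apply: measurable_and; [apply: measurable_fun_ler|apply: measurable_fun_ltr].
  apply: measurable_funM => //.
  apply: measurableT_comp mf0 _; apply/measurable_fun_tnthP => i.
  rewrite (_ : _ \o _ = fun z : R * R => orbit_prod z.1 (m.+1 - i)%N * z.2^-1); last first.
    by apply/funext => e /=; rewrite tnth_mktuple.
  by apply: measurable_funM.
have mGE : measurable_fun setT (EFin \o G) by exact/measurable_EFinP.
rewrite (_ : block_fun = fun x => fine (\int[leb]_u ((EFin \o G)^\+ (x, u))%E -
    \int[leb]_u ((EFin \o G)^\- (x, u))%E)%E); last first.
  apply/funext => x; rewrite /block_fun /Rintegral integralE.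
  by congr (fine (_ - _)%E); apply: eq_integral => u _; rewrite ?funeposE ?funenegE.
apply: measurableT_comp => //; apply: emeasurable_funB.
- apply: (@measurable_fun_fubini_tonelli_F _ _ _ _ R leb (EFin \o G)^\+%E) => //.
  exact: measurable_funepos.
- apply: (@measurable_fun_fubini_tonelli_F _ _ _ _ R leb (EFin \o G)^\-%E) => //.
  exact: measurable_funeneg.
Qed.

Lemma block_fun_bound (x : R) : `|block_fun x| <= M * `|ln (iter m T x)|.
Proof.
rewrite /block_fun; case: ltP => [D0|_]; last first.
  by rewrite /Rintegral integral0/= normr0 mulr_ge0// bound_ge0.
have [h|h] := leP (orbit_prod x m.+1) (orbit_prod x m); last first.
  rewrite /Rintegral integral0_eq/= ?normr0 ?mulr_ge0 ?bound_ge0// => e _.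
  rewrite /block; case: ifP => // /andP[h1 h2].
  by have := lt_trans h (le_lt_trans h1 h2); rewrite ltxx.
have [_ /le_trans] := @block_integrable _ _ M (orbit_prod x m.+1) (orbit_prod x m)
  (measurable_block (orbit_prod x) m) D0 h
  (fun e => block_bound e D0 (lexx _) (lexx _)); apply.
rewrite ler_wpM2l ?bound_ge0//.
have Dm : 0 < orbit_prod x m := lt_le_trans D0 h.
have Tm : 0 < iter m T x by move: D0; rewrite orbit_prodS pmulr_rgt0.
rewrite orbit_prodS lnM ?posrE// opprD addrA subrr sub0r.
by rewrite -normrN ler_norm.
Qed.

Lemma integrable_block_fun : P.-integrable setT (EFin \o block_fun).
Proof.
have iln : P.-integrable setT (EFin \o (fun x => ln (iter m T x))).
  elim: (m) => [|k IH]; first exact: integrable_ln_gauss.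
  have := @integrable_invariant _ (measurableTypeR R) R P T
    (@measurable_gaussT R) (@gauss_measure_invariant R) _ IH.
  by congr (_.-integrable _ _); apply/funext => x /=; rewrite -iterSr.
have iMln : P.-integrable setT (EFin \o (fun x => M * ln (iter m T x))).
  by have := integrableZl measurableT M iln.
apply: le_integrable iMln => //; first by apply/measurable_EFinP; exact: measurable_block_fun.
by move=> x _ /=; rewrite lee_fin normrM (ger0_norm bound_ge0) block_fun_bound.
Qed.

End blocks.

Section block_sums.
Context {R : realType} (m : nat) (f0 : m.+1.-tuple R -> R) (M : R).
Hypothesis mf0 : measurable_fun setT f0.
Hypothesis f0M : forall x, `|f0 x| <= M.
Local Notation leb := (@lebesgue_measure R).
Local Notation T := (@gaussT R).

Lemma Rintegral_sum (k : nat -> R -> R) n :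
  (forall i, leb.-integrable setT (EFin \o k i)) ->
  leb.-integrable setT (EFin \o (fun e => \sum_(i < n) k i e)) /\
  \int[leb]_e (\sum_(i < n) k i e) = \sum_(i < n) \int[leb]_e k i e.
Proof.
move=> ik; elim: n => [|n [IHi IHe]].
  have -> : (fun e => \sum_(i < 0) k i e) = cst 0 by apply/funext => e; rewrite big_ord0.
  by rewrite big_ord0 /Rintegral integral0; split => //; exact: integrable0.
have -> : (fun e => \sum_(i < n.+1) k i e) = (fun e => \sum_(i < n) k i e + k n e).
  by apply/funext => e; rewrite big_ord_recr.
rewrite big_ord_recr/= -IHe RintegralD//; split => //.
exact: (integrableD measurableT IHi (ik n)).
Qed.

Lemma block_eq0 (D : nat -> R) n e : ~~ (D n.+1 <= e < D n) -> block f0 D n e = 0.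
Proof. by rewrite /block => /negbTE ->. Qed.

Lemma block_delta (x e : R) n : regular x ->
  orbit_prod x n.+1 <= e < orbit_prod x n ->
  block f0 (orbit_prod x) n e = f0 (delta_vec m x e) / e.
Proof.
move=> xr h; rewrite /block h; congr (f0 _ / _); apply: eq_from_tnth => i.
by rewrite !tnth_mktuple /cf_delta (cf_N_eq xr h) cf_dE.
Qed.

(** Block [k] carries the constant sign [s ^+ k.+1]. The blocks below [n] lie entirely in the range
    of integration; the error is the part of block [n] above [eta]. *)
Lemma integral_blocks (s x eta : R) n : `|s| = 1 -> regular x ->
  orbit_prod x n.+1 <= eta < orbit_prod x n ->
  `|\int[leb]_(e in `[eta, 1]) (s ^+ cf_N x e * f0 (delta_vec m x e) / e) -
    \sum_(k < n) s ^+ k.+1 * \int[leb]_e block f0 (orbit_prod x) k e| <=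
  M * (ln (orbit_prod x n) - ln (orbit_prod x n.+1)).
Proof.
move=> s1 xr /andP[etaD etaD'].
set h := fun e => s ^+ cf_N x e * f0 (delta_vec m x e) / e.
have Dpos k := orbit_prod_gt0 k xr.
have eta0 : 0 < eta := lt_le_trans (Dpos _) etaD.
have Dnd := orbit_prod_nd xr.
pose r e := if eta <= e < orbit_prod x n then s ^+ n.+1 * block f0 (orbit_prod x) n e else 0.
pose S e := \sum_(k < n) s ^+ k.+1 * block f0 (orbit_prod x) k e + r e.
have iblock k : leb.-integrable setT
    (EFin \o (fun e => s ^+ k.+1 * block f0 (orbit_prod x) k e)).
  by have [ib _] := integral_block mf0 f0M k xr; have := integrableZl measurableT (s ^+ k.+1) ib.
have [ir rM] : leb.-integrable setT (EFin \o r) /\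
    `|\int[leb]_e r e| <= M * (ln (orbit_prod x n) - ln eta).
  apply: block_integrable => //; last 2 first.
  - exact: ltW.
  - move=> e; rewrite /r /inv_window; case: ifP => [/andP[h1 h2]|_]; last by rewrite normr0 mulr0.
    rewrite normrM normrX s1 expr1n mul1r.
    apply: (le_trans (block_bound f0M e (Dpos n.+1) (lexx _) (lexx _))).
    by rewrite /inv_window (le_trans etaD h1) h2.
  - apply: measurable_itv_if; apply: measurable_funM => //.
    exact: measurable_block.
have [isum sumE] := Rintegral_sum n iblock.
have iS : leb.-integrable setT (EFin \o S) by exact: (integrableD measurableT isum ir).
(* Each point of [[eta, 1[] lies in exactly one block, so at most one term of [S] survives. The
   point 1 lies in no block, since [d_0 = 1], and is dropped as a null set. *)
have SE : S = h \_ `[eta, 1[.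
  apply/funext => e; rewrite patchE; case: ifPn; rewrite ?inE ?notin_setE/= in_itv/=.
    move=> /andP[h1 h2].
    have [k hk] := block_exists xr (introT andP (conj (lt_le_trans eta0 h1) h2)).
    have he : s ^+ k.+1 * block f0 (orbit_prod x) k e = h e.
      by rewrite (block_delta xr hk) mulrA /h (cf_N_eq xr hk).
    have /andP[hk1 hk2] := hk.
    have kn : (k <= n)%N.
      rewrite leqNgt; apply/negP => /Dnd /(lt_le_trans hk2) => h3.
      by have := lt_le_trans h3 (le_trans etaD h1); rewrite ltxx.
    have off i : i != k -> block f0 (orbit_prod x) i e = 0.
      move=> ik; apply: block_eq0; apply/negP => /andP[hi1 hi2].
      move: ik; rewrite neq_ltn => /orP[/Dnd|/Dnd] h3.
        by have := lt_le_trans hk2 (le_trans h3 hi1); rewrite ltxx.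
      by have := lt_le_trans hi2 (le_trans h3 hk1); rewrite ltxx.
    rewrite /S /r h1/=; move: kn; rewrite leq_eqVlt => /predU1P[kn|kn].
      rewrite -kn hk2 big1 ?add0r// => i _; rewrite off ?mulr0//.
      by rewrite neq_ltn ltn_ord.
    rewrite ltNge (le_trans (Dnd _ _ kn) hk1)/= addr0.
    rewrite (bigD1 (Ordinal kn))//= big1 ?addr0// => i ik.
    by rewrite off ?mulr0.
  move=> /negP; rewrite negb_and -ltNge -leNgt => he.
  have hz k : (k < n)%N -> block f0 (orbit_prod x) k e = 0.
    move=> kn; apply: block_eq0; rewrite negb_and -ltNge -leNgt.
    case/orP: he => he; apply/orP; [left|right].
      by apply: (lt_le_trans he); apply: (le_trans (ltW etaD')); exact: Dnd.
    by rewrite (le_trans _ he)// -(orbit_prod0 x); exact: Dnd.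
  rewrite /S big1 ?add0r => [|i _]; last by rewrite hz ?mulr0.
  rewrite /r; case: ifP => // /andP[h1 h2]; case/orP: he => he.
    by move: h1; rewrite leNgt he.
  have := lt_le_trans h2 (Dnd _ _ (leq0n n)); rewrite orbit_prod0 => /lt_le_trans/(_ he).
  by rewrite ltxx.
have mI : measurable (`[eta, 1[ : set R) by exact: measurable_itv.
have ih : leb.-integrable `[eta, 1[ (EFin \o h).
  apply: (@integrable_mkcond _ (measurableTypeR R) R leb _ (EFin \o h) mI).2.
  rewrite (_ : _ \_ _ = EFin \o S)// SE; apply/funext => e /=.
  by rewrite !patchE; case: ifP.
have -> : \int[leb]_(e in `[eta, 1]) h e = \int[leb]_e S e.
  by rewrite -Rintegral_itv_bndo_bndc// Rintegral_mkcond SE.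
rewrite /S RintegralD// sumE.
have -> : \sum_(i < n) \int[leb]_e (s ^+ i.+1 * block f0 (orbit_prod x) i e) =
    \sum_(k < n) s ^+ k.+1 * \int[leb]_e block f0 (orbit_prod x) k e.
  apply: eq_bigr => k _; rewrite RintegralZl//.
  by have [] := integral_block mf0 f0M k xr.
rewrite addrAC subrr add0r; apply: (le_trans rM).
by rewrite ler_wpM2l ?(bound_ge0 f0M)// lerD2l lerN2 ler_ln ?posrE.
Qed.

(** Only blocks of index [j + m] are values of [block_fun]; the first [m], where indices may be
    truncated, give a constant that the average kills. The factor [s ^+ m.+1] is the offset between
    [j] and [cf_N = j + m + 1]. *)
Lemma cvg_block_sums (s x v : R) : regular x ->
  (\sum_(j < n) s ^+ j * block_fun f0 (iter j T x)) / n%:R @[n --> \oo] --> v ->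
  (\sum_(k < n) s ^+ k.+1 * \int[leb]_e block f0 (orbit_prod x) k e) / n%:R
    @[n --> \oo] --> s ^+ m.+1 * v.
Proof.
move=> xr xv; apply: (@cvg_average_shift _ m).
pose A n := \sum_(k < n) s ^+ k.+1 * \int[leb]_e block f0 (orbit_prod x) k e.
have AE n : A (n + m)%N =
    A m + s ^+ m.+1 * \sum_(j < n) s ^+ j * block_fun f0 (iter j T x).
  elim: n => [|n IH]; first by rewrite big_ord0 mulr0 addr0.
  rewrite addSn {1}/A big_ord_recr/= -/(A (n + m)%N) IH integral_block_shift//.
  by rewrite big_ord_recr/= mulrDr addrA mulrA -exprD addSn addnC.
have h : A m * n%:R^-1 + s ^+ m.+1 * ((\sum_(j < n) s ^+ j * block_fun f0 (iter j T x)) / n%:R)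
    @[n --> \oo] --> s ^+ m.+1 * v.
  rewrite -[X in _ --> X]add0r -[X in _ --> X + _](mulr0 (A m)).
  by apply: cvgD; apply: cvgMr => //; exact: cvg_natV.
apply: cvg_trans h; apply: near_eq_cvg; apply: nearW => n.
by rewrite -/(A _) AE mulrDl mulrA.
Qed.

(** [I] is abstract and constrained only for positive [eta], so that the integrals of the theorem,
    with [f] for [f0] and without a factor [1 ^+ cf_N], can be put in its place. *)
Lemma cvg_log_average (s x v l : R) (I : R -> R) : `|s| = 1 -> regular x ->
  (\sum_(j < n) ln (iter j T x)) / n%:R @[n --> \oo] --> - l ->
  (\sum_(j < n) s ^+ j * block_fun f0 (iter j T x)) / n%:R @[n --> \oo] --> v ->
  (forall eta, 0 < eta -> I eta =
    \int[leb]_(e in `[eta, 1]) (s ^+ cf_N x e * f0 (delta_vec m x e) / e)) ->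
  (ln eta^-1)^-1 * I eta @[eta --> 0^'+] --> s ^+ m.+1 * v / l.
Proof.
move=> s1 xr xl xv IE.
have xl' : - ln (orbit_prod x n) / n%:R @[n --> \oo] --> l.
  rewrite -[l]opprK; under eq_fun do rewrite ln_orbit_prod// mulNr.
  exact: cvgN.
apply: (@cvg_time_change _ I _ (orbit_prod x) _ _ M _
  (bound_ge0 f0M) _ _ _ _ xl' (cvg_block_sums xr xv)).
- exact: orbit_rate_gt0 xr xl'.
- exact: orbit_prod0.
- by move=> n; exact: orbit_prod_gt0.
- by move=> n; exact: orbit_prodS_lt.
- by move=> eta; exact: orbit_prod_small.
- move=> eta n h; rewrite IE ?integral_blocks//.
  by case/andP: h => h _; apply: lt_le_trans h; exact: orbit_prod_gt0.
Qed.

End block_sums.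

(** * The two limits *)

Unset Implicit Arguments. Set Strict Implicit. Set Printing Implicit Defensive.

Theorem theorem4p2 (R : realType) (m : nat) (f : m.+1.-tuple R -> R) :
  measurable_fun [set x : m.+1.-tuple R | forall i, 0 <= tnth x i] f ->
  (exists M : R, forall x : m.+1.-tuple R,
      (forall i, 0 <= tnth x i) -> `|f x| <= M) ->
  exists L : R,
    {ae (@lebesgue_measure R), forall alpha : R, alpha \in `]0, 1[ ->
      ((fun eta : R => (ln eta^-1)^-1 *
          Rintegral (@lebesgue_measure R) `[eta, 1]
            (fun eps => f (delta_vec m alpha eps) / eps))
         @ (0:R)^'+ --> L)
      /\
      ((fun eta : R => (ln eta^-1)^-1 *
          Rintegral (@lebesgue_measure R) `[eta, 1]
            (fun eps => (-1) ^+ cf_N alpha eps * f (delta_vec m alpha eps) / eps))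
         @ (0:R)^'+ --> 0)}.
Proof.
set D := [set x | _] => mf [M fM].
have mD : measurable D.
  rewrite (_ : D = \bigcap_(i in [set: 'I_m.+1]) ((fun x => tnth x i) @^-1` `[0, +oo[)).
    apply: fin_bigcap_measurable => // i _.
    by rewrite -[X in measurable X]setTI; apply: measurable_tnth.
  apply/seteqP; split => [x Dx i _|x h i]; first by rewrite /= in_itv/= Dx.
  by have := h i I; rewrite /= in_itv/= andbT.
(* Measurability and boundedness of [f] are given on [D] only; extension by 0 makes them global, and
   vectors of distances over a positive [eps] always lie in [D]. *)
pose f0 := f \_ D.
have mf0 : measurable_fun setT f0 by apply/measurable_restrict => //; rewrite setTI.
have M0 : 0 <= M.
  by apply: (le_trans (normr_ge0 (f [tuple 0 | i < m.+1]))); apply: fM => i; rewrite tnth_mktuple.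
have f0M x : `|f0 x| <= M.
  by rewrite /f0 patchE; case: ifPn; rewrite ?normr0// inE => /fM.
have f0E alpha eps : 0 < eps -> f (delta_vec m alpha eps) = f0 (delta_vec m alpha eps).
  move=> eps0; rewrite /f0 patchE mem_set// => i.
  by rewrite tnth_mktuple /cf_delta divr_ge0 ?normr_ge0// ltW.
exists (\int[@gauss_measure R]_x block_fun f0 x / (- \int[@gauss_measure R]_x ln x)).
(* Three null sets are discarded: the irregular points and the exceptional sets of the ergodic
   theorem for [block_fun] and for [ln]. *)
apply: (negligibleS _ (negligibleU (negligibleU (@ae_regular R)
  (birkhoff_gaussT (integrable_block_fun mf0 f0M))) (birkhoff_gaussT (@integrable_ln_gauss R)))).
move=> x /= nc; apply: contrapT => /not_orP[/not_orP[/contrapT hr /contrapT hb] /contrapT hl].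
apply: nc; rewrite inE/= in_itv/= => x01.
have xr := hr x01; have [hb1 hb2] := hb x01; have [hl1 _] := hl x01.
rewrite -[X in _ --> X]opprK in hl1.
split.
- have := @cvg_log_average R m f0 M mf0 f0M 1 x
    (\int[@gauss_measure R]_x block_fun f0 x) _ _ (normr1 R) xr hl1.
  rewrite (expr1n R m.+1) mul1r; apply.
    by under eq_fun do under eq_bigr do rewrite expr1n mul1r.
  move=> eta eta0; apply: eq_Rintegral => e; rewrite inE/= in_itv/= => /andP[he _].
  by rewrite expr1n mul1r f0E// (lt_le_trans eta0).
- have := @cvg_log_average R m f0 M mf0 f0M (-1) x 0 _ _ _ xr hl1 hb2.
  rewrite mulr0 mul0r; apply; first by rewrite normrN1.
  move=> eta eta0; apply: eq_Rintegral => e; rewrite inE/= in_itv/= => /andP[he _].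
  by rewrite f0E// (lt_le_trans eta0).
Qed.
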